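(* Let $X$ be a compact topological space, let $A,B\subset X$ be subspaces such that $X$ is the union of the interiors of $A$ and $B$, let $\phi\colon X\to\mathbb{R}$ be a continuous function, and let $\emptyset=X_0\subset X_1\subset\cdots\subset X_n=X$ be a filtration of $X$ by sublevel sets of $\phi$, with induced filtrations $A_u=A\cap X_u$, $B_u=B\cap X_u$, $(A\cap B)_u=A\cap B\cap X_u$. Let $\mathbf{F}$ be a field and let $\mathcal{H}_k(\cdot)$ denote the $k$-th graded persistence module over $\mathbf{F}[x]$. Then the Mayer-Vietoris sequence of graded persistence modules $$\cdots\longrightarrow \mathcal{H}_{k+1}(X)\xrightarrow{\ \delta\ }\mathcal{H}_k(A\cap B)\xrightarrow{\ \alpha\ }\mathcal{H}_k(A)\oplus\mathcal{H}_k(B)\xrightarrow{\ \beta\ }\mathcal{H}_k(X)\longrightarrow\cdots$$ with $$\delta(m^0,m^1,\ldots)=(\delta_k^0(m^0),\delta_k^1(m^1),\ldots),$$ $$\alpha(y^0,y^1,\ldots)=\big((s_k^0(y^0),s_k^1(y^1),\ldots),(t_k^0(y^0),t_k^1(y^1),\ldots)\big),$$ $$\beta(a,b)=(\beta_k^0(a^0,b^0),\beta_k^1(a^1,b^1),\ldots),$$ for all $m^u\in H_{k+1}(X_u)$, $y^u\in H_k((A\cap B)_u)$, $a^u\in H_k(A_u)$, $b^u\in H_k(B_u)$ (where $a=(a^u)_u$, $b=(b^u)_u$), is exact. That is, at every position of the sequence, (1) $\operatorname{Im}\delta=\operatorname{Ker}\alpha$; (2) $\operatorname{Im}\alpha=\operatorname{Ker}\beta$;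 (3) $\operatorname{Im}\beta=\operatorname{Ker}\delta$, where in (3) $\delta$ is the next map $\mathcal{H}_k(X)\to\mathcal{H}_{k-1}(A\cap B)$.
   Context: All homology is singular homology with coefficients in a fixed field $\mathbf{F}$; $H_k=0$ for $k<0$. Filtration: fix real numbers $r_0<r_1<\cdots<r_n$ and set $X_u=\{x\in X\mid \phi(x)\le r_u\}$ for $0\le u\le n$, with $X_0=\emptyset$ and $X_n=X$; by convention $X_u=X$ for $u\ge n$. For a subspace $Y\in\{X,A,B,A\cap B\}$, $Y_u=Y\cap X_u$. Graded persistence module: for such $Y$, write $H_k^u(Y)=H_k(Y_u;\mathbf{F})$, and let $i_k^u\colon H_k^u(Y)\to H_k^{u+1}(Y)$ be induced by the inclusion $Y_u\hookrightarrow Y_{u+1}$ (the identity for $u\ge n$). The $k$-th graded persistence module is $\mathcal{H}_k(Y)=\bigoplus_{u\ge 0}H_k^u(Y)$ (with $H_k^u(Y)=H_k^n(Y)$ for $u\ge n$), a graded $\mathbf{F}[x]$-module with action $x\cdot(m^0,m^1,m^2,\ldots)=(0,i_k^0(m^0),i_k^1(m^1),\ldots)$. Level maps: for each $u$, - $\delta_k^u\colon H_{k+1}(X_u)\to H_k((A\cap B)_u)$ is the usual Mayer-Vietoris connecting homomorphism of the triad $(X_u,A_u,B_u)$, $\delta_k^u([x])=[\partial(x|_A)]$, i.e. if the cycle $x$ is written as $a+b$ with $a$ a chain in $A_u$ and $b$ a chain in $B_u$, then $\delta_k^u([x])=[\partial a]$; - $s_k^u\colon H_k((A\cap B)_u)\to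 H_k(A_u)$, $s_k^u([y])=[y]$; - $t_k^u\colon H_k((A\cap B)_u)\to H_k(B_u)$, $t_k^u([y])=[-y]$; - $\beta_k^u\colon H_k(A_u)\oplus H_k(B_u)\to H_k(X_u)$, $\beta_k^u([z],[z'])=[z+z']$. *)

(* Defs.v *)
From HB Require Import structures.
From mathcomp Require Import all_boot all_order all_algebra.
From mathcomp Require Import all_classical.
From mathcomp Require Import reals topology normedtype.
From mathcomp Require Import freeg.

Set Implicit Arguments.
Unset Strict Implicit.
Unset Printing Implicit Defensive.

Import Order.TTheory GRing.Theory Num.Theory numFieldNormedType.Exports.

Local Open Scope classical_set_scope.
Local Open Scope ring_scope.

Section LmodQuotient.
Local Open Scope quotient_scope.
Variables (F : fieldType) (V : lmodType F) (I : V -> bool).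
Hypothesis I_submod : submod_closed I.

Definition lquot_ideal : zmodClosed V :=
  HB.pack I (GRing.isZmodClosed.Build V I (GRing.submod_closedB I_submod)).

Definition lquot := Quotient.quot lquot_ideal.

HB.instance Definition _ := GRing.Zmodule.on lquot.

Definition lproj (v : V) : lquot := \pi_(Quotient.quot lquot_ideal) v.

Lemma lproj_eq (v w : V) : (lproj v == lproj w) = (v - w \in I).
Proof. exact: esym (Quotient.idealrBE _ _ _). Qed.

Lemma lproj_repr (q : lquot) : lproj (repr (q : Quotient.quot lquot_ideal)) = q.
Proof. exact: reprK. Qed.

Lemma lprojB : {morph lproj : v w / v - w}.
Proof. exact: (raddfB (\pi_(Quotient.quot lquot_ideal))). Qed.

Lemma lprojD : {morph lproj : v w / v + w}.
Proof. exact: (raddfD (\pi_(Quotient.quot lquot_ideal))). Qed.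

Definition lquot_scale (a : F) (q : lquot) : lquot :=
  lproj (a *: repr (q : Quotient.quot lquot_ideal)).

Lemma lproj_scale a v : lquot_scale a (lproj v) = lproj (a *: v).
Proof.
have I_scale := GRing.subsemimod_closedZ (GRing.submod_closed_semi I_submod).
apply/eqP; rewrite lproj_eq -scalerBr; apply: I_scale; rewrite -lproj_eq.
by apply/eqP; exact: lproj_repr.
Qed.

Lemma lquot_scaleA a b q :
  lquot_scale a (lquot_scale b q) = lquot_scale (a * b) q.
Proof. by rewrite -[q]lproj_repr !lproj_scale scalerA. Qed.

Lemma lquot_scale1 : left_id 1 lquot_scale.
Proof. by move=> q; rewrite -[q]lproj_repr lproj_scale scale1r. Qed.

Lemma lquot_scaleDr : right_distributive lquot_scale +%R.
Proof.
move=> a p q; rewrite -[p]lproj_repr -[q]lproj_repr -lprojD !lproj_scale.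
by rewrite scalerDr lprojD.
Qed.

Lemma lquot_scaleDl q : {morph lquot_scale^~ q : a b / a + b}.
Proof.
by move=> a b; rewrite -[q]lproj_repr !lproj_scale scalerDl lprojD.
Qed.

HB.instance Definition _ := GRing.Zmodule_isLmodule.Build F lquot
  lquot_scaleA lquot_scale1 lquot_scaleDr lquot_scaleDl.

Lemma lproj_linear : linear lproj.
Proof. by move=> a v w; rewrite lprojD -lproj_scale. Qed.

HB.instance Definition _ := GRing.isLinear.Build F V lquot _ lproj lproj_linear.

End LmodQuotient.

Section Cycles.
Variables (F : fieldType) (V W : lmodType F) (d0 : {linear V -> W}).

Definition is_cycle : pred V := fun v => d0 v == 0.

Lemma is_cycle_submod : submod_closed is_cycle.
Proof.
split=> [|a v w]; rewrite !unfold_in /is_cycle ?linear0 //.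
by move=> /eqP v0 /eqP w0; rewrite linearP v0 w0 scaler0 addr0.
Qed.

HB.instance Definition _ :=
  GRing.isSubmodClosed.Build F V is_cycle is_cycle_submod.

Record cycles := Cycle { chain_of : V; _ : is_cycle chain_of }.

HB.instance Definition _ := [isSub for chain_of].
HB.instance Definition _ := [Choice of cycles by <:].
HB.instance Definition _ := [SubChoice_isSubLmodule of cycles by <:].

Lemma chain_of_linear : linear chain_of.
Proof. exact: (linearP (val : cycles -> V)). Qed.

HB.instance Definition _ :=
  GRing.isLinear.Build F cycles V _ chain_of chain_of_linear.

Lemma cycleP (z : cycles) : d0 (chain_of z) = 0.
Proof. by case: z => v v0; apply/eqP. Qed.

End Cycles.

Section Homology.
Variables (F : fieldType) (U V W : lmodType F).
Variables (d1 : {linear U -> V}) (d0 : {linear V -> W}).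

Definition is_boundary : pred (cycles d0) :=
  fun z => `[< exists c : U, chain_of z = d1 c >].

Lemma is_boundary_submod : submod_closed is_boundary.
Proof.
split=> [|a z w]; first by apply/asboolP; exists 0; rewrite !linear0.
move=> zB wB; have [c zc] := asboolW zB; have [e we] := asboolW wB.
apply/asboolP; exists (a *: c + e).
by rewrite chain_of_linear zc we linearP.
Qed.

Definition homology : lmodType F := lquot is_boundary_submod.

Definition hclass : {linear cycles d0 -> homology} :=
  @lproj F (cycles d0) is_boundary is_boundary_submod.

Lemma hclass_eq z w :
  hclass z = hclass w <-> exists c : U, chain_of z - chain_of w = d1 c.
Proof.
split=> [/eqP|[c zwc]].
  by rewrite /hclass /= lproj_eq => /asboolW[c]; rewrite linearB; exists c.
by apply/eqP; rewrite lproj_eq; apply/asboolP; exists c; rewrite linearB.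
Qed.

Lemma hclass_repr (h : homology) : hclass (repr h) = h.
Proof. exact: lproj_repr. Qed.

End Homology.

Section InducedMap.
Variables (F : fieldType) (U V W U' V' W' : lmodType F).
Variables (d1 : {linear U -> V}) (d0 : {linear V -> W}).
Variables (d1' : {linear U' -> V'}) (d0' : {linear V' -> W'}).
Variables (g1 : {linear U -> U'}) (g0 : {linear V -> V'}).
Variables (g : {linear W -> W'}).
Hypothesis g1P : forall c, d1' (g1 c) = g0 (d1 c).
Hypothesis g0P : forall c, d0' (g0 c) = g (d0 c).

Lemma cycle_map_subproof (z : cycles d0) : is_cycle d0' (g0 (chain_of z)).
Proof. by apply/eqP; rewrite g0P cycleP linear0. Qed.

Definition cycle_map (z : cycles d0) : cycles d0' :=
  Cycle (cycle_map_subproof z).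

Lemma cycle_map_linear : linear cycle_map.
Proof. by move=> a z w; apply: val_inj; rewrite /= !linearP. Qed.

HB.instance Definition _ :=
  GRing.isLinear.Build F (cycles d0) (cycles d0') _ cycle_map cycle_map_linear.

Definition homology_map (h : homology d1 d0) : homology d1' d0' :=
  hclass d1' d0' (cycle_map (repr h)).

Lemma homology_mapE z :
  homology_map (hclass d1 d0 z) = hclass d1' d0' (cycle_map z).
Proof.
have /hclass_eq[c zc] := hclass_repr (hclass d1 d0 z).
by apply/hclass_eq; exists (g1 c); rewrite g1P -zc linearB.
Qed.

Lemma homology_map_linear : linear homology_map.
Proof.
move=> a h k; rewrite -[h]hclass_repr -[k]hclass_repr -linearP.
by rewrite !homology_mapE !linearP.
Qed.

Definition induced_map : {linear homology d1 d0 -> homology d1' d0'} :=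
  HB.pack homology_map (GRing.isLinear.Build F
    (homology d1 d0) (homology d1' d0') _ homology_map homology_map_linear).

End InducedMap.

Lemma continuous_mx (T U : topologicalType) m n (f : T -> 'M[U]_(m, n)) :
  (forall i j, continuous (fun x => f x i j)) -> continuous f.
Proof.
move=> cf x A [P nP /= PA].
apply: (filterS PA); apply: filter_forall => i; apply: filter_forall => j.
exact: cf (nP i j).
Qed.

Section StandardSimplex.
Variable R : realType.

Definition std_simplex (k : nat) : set 'rV[R]_k.+1 :=
  [set v | (forall i, 0 <= v ord0 i) /\ \sum_i v ord0 i = 1].

Definition simplex (k : nat) : topologicalType :=
  set_type (std_simplex (k := k)).

Lemma face_subproof k (i : 'I_k.+2) (v : simplex k) :
  std_simplex (\row_j oapp (fun j' => set_val v ord0 j') 0 (unlift i j)).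
Proof.
have [v0 v1] := set_valP v; split=> [j|].
  by rewrite mxE; case: unlift => //= j'; exact: v0.
rewrite (bigD1_ord i) //= mxE unlift_none /= add0r -[RHS]v1.
by apply: eq_bigr => j _; rewrite mxE liftK.
Qed.

(* The [i]-th face inclusion inserts a zero in position [i]. *)
Definition face_fun k (i : 'I_k.+2) (v : simplex k) : simplex k.+1 :=
  SigSub (mem_set (face_subproof i v)).

Lemma face_continuous k (i : 'I_k.+2) : continuous (face_fun i).
Proof.
apply: continuous_comp_initial; apply: continuous_mx => a j.
rewrite (_ : (fun x => _) =
  fun v : simplex k => oapp (fun j' => set_val v ord0 j') 0 (unlift i j)).
  case: unlift => [j'|] /=; last exact: (@cst_continuous (simplex k) R 0).
  move=> v; apply: (@continuous_comp (simplex k) 'rV[R]_k.+1 R set_val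
    (fun M : 'rV[R]_k.+1 => M ord0 j')).
    exact: initial_continuous.
  exact: coord_continuous.
by apply/funext => v; rewrite [LHS]mxE.
Qed.

Definition face k (i : 'I_k.+2) : continuousType (simplex k) (simplex k.+1) :=
  mkcts (@face_continuous k i).

End StandardSimplex.


Section Chains.
Variables (R : realType) (F : fieldType).

Definition singular_simplex (k : nat) (Y : topologicalType) : choiceType :=
  continuousType (simplex R k) Y.

Definition chains (k : nat) (Y : topologicalType) : lmodType F :=
  {freeg (singular_simplex k Y) / F}.

HB.instance Definition _ (K : choiceType) (M : lmodType F) (f : K -> M) :=
  GRing.isZmodMorphism.Build {freeg K / F} M (fglift f) (lift_is_additive f).

Lemma freegU_scale (K : choiceType) (a : F) (x : K) :
  << a *g x >> = a *: << x >> :> {freeg K / F}.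
Proof. by apply/eqP/freeg_eqP => y; rewrite coeffZ !coeffU mul1r. Qed.

Lemma fglift_linear (K : choiceType) (M : lmodType F) (f : K -> M) :
  linear (fglift f : {freeg K / F} -> M).
Proof.
move=> a c d; rewrite raddfD; congr (_ + _).
have fcE : fglift f c = \sum_(x <- dom c) coeff x c *: f x.
  rewrite -{1}[c]freeg_sumE raddf_sum.
  by apply: eq_bigr => x _; rewrite /= liftU.
rewrite fcE scaler_sumr -[a *: c]/(fgscale a c) /fgscale raddf_sum.
by apply: eq_bigr => x _; rewrite /= liftU scalerA.
Qed.

HB.instance Definition _ (K : choiceType) (M : lmodType F) (f : K -> M) :=
  GRing.isLinear.Build F {freeg K / F} M _ (fglift f) (fglift_linear f).

Definition simplex_boundary k (Y : topologicalType)
    (s : singular_simplex k.+1 Y) : chains k Y :=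
  \sum_(i < k.+2) << (-1) ^+ i *g (s \o face R i : singular_simplex k Y) >>.

(* The boundary is zero in degree 0, so that every 0-chain is a cycle. *)
Definition boundary (k : nat) (Y : topologicalType) :
    {linear chains k Y -> chains k.-1 Y} :=
  if k is k'.+1 then fglift (@simplex_boundary k' Y) else \0.

Definition chain_map (Y Z : topologicalType) (f : continuousType Y Z) k :
    {linear chains k Y -> chains k Z} :=
  fglift (fun s : singular_simplex k Y =>
    << (f \o s : singular_simplex k Z) >>).

Lemma chain_map_boundary (Y Z : topologicalType) (f : continuousType Y Z) k
    (c : chains k Y) :
  boundary k Z (chain_map f k c) = chain_map f k.-1 (boundary k Y c).
Proof.
case: k c => [|k] c /=; first by rewrite linear0.
rewrite -[c]freeg_sumE !linear_sum; apply: eq_bigr => s _ /=.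
rewrite !liftU !linearZ /= !liftU scale1r; congr (_ *: _).
rewrite [RHS]linear_sum; apply: eq_bigr => i _; rewrite /= liftU.
rewrite freegU_scale; congr (_ *: << _ >>).
exact/continuousEP.
Qed.

Definition singular_homology (k : nat) (Y : topologicalType) : lmodType F :=
  homology (boundary k.+1 Y) (boundary k Y).

Definition singular_homology_map (Y Z : topologicalType)
    (f : continuousType Y Z) k :
    {linear singular_homology k Y -> singular_homology k Z} :=
  induced_map (@chain_map_boundary _ _ f k.+1) (@chain_map_boundary _ _ f k).

Lemma singular_homology_mapE (Y Z : topologicalType)
    (f : continuousType Y Z) k (z : cycles (boundary k Y)) :
  singular_homology_map f k (hclass _ _ z) =
  hclass _ _ (cycle_map (@chain_map_boundary _ _ f k) z).
Proof.
exact: (homology_mapE (@chain_map_boundary _ _ f k.+1)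
                      (@chain_map_boundary _ _ f k)).
Qed.

(* Homology in all integral degrees: it vanishes in negative degrees. *)
Definition Hsing (k : int) (Y : topologicalType) : lmodType F :=
  if k is Posz k' then singular_homology k' Y else 'rV[F]_0.

Definition Hsing_map (Y Z : topologicalType) (f : continuousType Y Z)
    (k : int) :
    {linear Hsing k Y -> Hsing k Z} :=
  if k is Posz k' then singular_homology_map f k' else \0.

Lemma chain_map_comp (Y Z T : topologicalType) (f : continuousType Y Z)
    (g : continuousType Z T) k (c : chains k Y) :
  chain_map (g \o f) k c = chain_map g k (chain_map f k c).
Proof.
rewrite -[c]freeg_sumE !linear_sum; apply: eq_bigr => s _.
by rewrite /= !liftU linearZ /= liftU scale1r; congr (_ *: << _ >>);
  exact/continuousEP.
Qed.

Lemma Hsing_map_comp (Y Z T : topologicalType) (f : continuousType Y Z)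
    (g : continuousType Z T) k (h : Hsing k Y) :
  Hsing_map (g \o f) k h = Hsing_map g k (Hsing_map f k h).
Proof.
case: k h => [k|k] // h.
have [z <-] : exists z, hclass _ _ z = h by exists (repr h); exact: hclass_repr.
rewrite /Hsing_map (singular_homology_mapE f z).
rewrite (singular_homology_mapE (g \o f) z) singular_homology_mapE.
congr (hclass _ _ _).
by apply: val_inj; exact: (chain_map_comp f g (chain_of z)).
Qed.

Lemma eq_Hsing_map (Y Z : topologicalType) (f g : continuousType Y Z) k
    (h : Hsing k Y) : f =1 g -> Hsing_map f k h = Hsing_map g k h.
Proof. by move=> /continuousEP ->. Qed.

End Chains.

Section Inclusion.
Variables (X : topologicalType).

Definition incl_fun (S T : set X) (ST : S `<=` T) (x : set_type S) :
    set_type T := SigSub (mem_set (ST _ (set_valP x))).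

Lemma incl_continuous (S T : set X) (ST : S `<=` T) : continuous (incl_fun ST).
Proof. by apply: continuous_comp_initial; exact: initial_continuous. Qed.

Definition incl (S T : set X) (ST : S `<=` T) :
    continuousType (set_type S) (set_type T) := mkcts (@incl_continuous S T ST).

End Inclusion.

Record persmod (F : fieldType) := PersMod {
  pers_level :> nat -> lmodType F;
  pers_map : forall u, {linear pers_level u -> pers_level u.+1} }.

Section GradedModule.
Variables (F : fieldType) (P : persmod F).

(* The direct sum of all levels: families with finitely many nonzero entries. *)
Record gradedmod := GradedMod {
  gcomp :> forall u, P u;
  gcomp_fin : exists N, forall u, (N <= u)%N -> gcomp u = 0 }.

HB.instance Definition _ := gen_eqMixin gradedmod.
HB.instance Definition _ := gen_choiceMixin gradedmod.

Lemma gradedmod_eq (m n : gradedmod) : (forall u, m u = n u) -> m = n.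
Proof.
case: m n => [m mfin] [n nfin] /= mn.
have {}mn : m = n by apply: boolp.functional_extensionality_dep.
by subst n; congr GradedMod; exact: Prop_irrelevance.
Qed.

Definition gzero : gradedmod.
Proof. by exists (fun u => 0); exists 0%N. Defined.

Definition gopp (m : gradedmod) : gradedmod.
Proof.
exists (fun u => - m u); have [N mN] := gcomp_fin m.
by exists N => u /mN ->; rewrite oppr0.
Defined.

Definition gadd (m n : gradedmod) : gradedmod.
Proof.
exists (fun u => m u + n u).
have [[N mN] [M nM]] := (gcomp_fin m, gcomp_fin n).
exists (maxn N M) => u; rewrite geq_max => /andP[/mN -> /nM ->].
by rewrite addr0.
Defined.

Lemma gaddA : associative gadd.
Proof. by move=> m n p; apply: gradedmod_eq => u; exact: addrA. Qed.

Lemma gaddC : commutative gadd.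
Proof. by move=> m n; apply: gradedmod_eq => u; exact: addrC. Qed.

Lemma gadd0 : left_id gzero gadd.
Proof. by move=> m; apply: gradedmod_eq => u; exact: add0r. Qed.

Lemma gaddN : left_inverse gzero gopp gadd.
Proof. by move=> m; apply: gradedmod_eq => u; exact: addNr. Qed.

HB.instance Definition _ :=
  GRing.isZmodule.Build gradedmod gaddA gaddC gadd0 gaddN.

Definition gscale (a : F) (m : gradedmod) : gradedmod.
Proof.
exists (fun u => a *: m u); have [N mN] := gcomp_fin m.
by exists N => u /mN ->; rewrite scaler0.
Defined.

(* The action of x: (m^0, m^1, m^2, ...) |-> (0, i^0 m^0, i^1 m^1, ...). *)
Definition gshift (m : gradedmod) : gradedmod.
Proof.
exists (fun u => if u is v.+1 then pers_map P v (m v) else 0).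
have [N mN] := gcomp_fin m; exists N.+1 => -[//|u] /mN ->.
by rewrite linear0.
Defined.

Definition gpoly_scale (p : {poly F}) (m : gradedmod) : gradedmod :=
  \sum_(i < size p) gscale p`_i (iter i gshift m).

Lemma gscaleD a : {morph gscale a : m n / m + n}.
Proof. by move=> m n; apply: gradedmod_eq => u; exact: scalerDr. Qed.

Lemma gscale0 a : gscale a 0 = 0.
Proof. by apply: gradedmod_eq => u; exact: scaler0. Qed.

Lemma gscaleDl m : {morph gscale^~ m : a b / a + b}.
Proof. by move=> a b; apply: gradedmod_eq => u; exact: scalerDl. Qed.

Lemma g0scale m : gscale 0 m = 0.
Proof. by apply: gradedmod_eq => u; exact: scale0r. Qed.

Lemma g1scale m : gscale 1 m = m.
Proof. by apply: gradedmod_eq => u; exact: scale1r. Qed.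

Lemma gscaleA a b m : gscale a (gscale b m) = gscale (a * b) m.
Proof. by apply: gradedmod_eq => u; exact: scalerA. Qed.

Lemma gscale_sum a (I : Type) (r : seq I) (m : I -> gradedmod) :
  gscale a (\sum_(i <- r) m i) = \sum_(i <- r) gscale a (m i).
Proof. exact: (big_morph _ (gscaleD a) (gscale0 a)). Qed.

Lemma gshiftD : {morph gshift : m n / m + n}.
Proof.
by move=> m n; apply: gradedmod_eq => -[|u] /=; rewrite ?addr0 ?linearD.
Qed.

Lemma gshift0 : gshift 0 = 0.
Proof. by apply: gradedmod_eq => -[|u] //=; exact: linear0. Qed.

Lemma gshift_scale a m : gshift (gscale a m) = gscale a (gshift m).
Proof.
by apply: gradedmod_eq => -[|u] /=; rewrite ?scaler0 ?linearZ.
Qed.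

Lemma iter_gshiftD i : {morph iter i gshift : m n / m + n}.
Proof. by elim: i => [|i IHi] m n //; rewrite !iterS IHi gshiftD. Qed.

Lemma gpoly_scaleE N (p : {poly F}) m : (size p <= N)%N ->
  gpoly_scale p m = \sum_(i < N) gscale p`_i (iter i gshift m).
Proof.
move=> pN; rewrite /gpoly_scale.
rewrite (big_ord_widen N (fun i => gscale p`_i (iter i gshift m))) //.
rewrite [LHS]big_mkcond; apply: eq_bigr => i _.
by case: ltnP => // pi; rewrite nth_default // g0scale.
Qed.

Lemma gpoly_scaleDl m : {morph gpoly_scale^~ m : p q / p + q}.
Proof.
move=> p q; set N := maxn (size p) (size q).
rewrite (gpoly_scaleE (N := N)) ?size_polyD //.
rewrite (gpoly_scaleE (N := N) (p := p)) ?leq_maxl //.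
rewrite (gpoly_scaleE (N := N) (p := q)) ?leq_maxr //.
by rewrite -big_split; apply: eq_bigr => i _; rewrite coefD gscaleDl.
Qed.

Lemma gpoly_scaleDr : right_distributive gpoly_scale +%R.
Proof.
move=> p m n; rewrite /gpoly_scale -big_split; apply: eq_bigr => i _.
by rewrite iter_gshiftD gscaleD.
Qed.

Lemma gpoly_scaleC c m : gpoly_scale c%:P m = gscale c m.
Proof.
by rewrite (gpoly_scaleE (N := 1)) ?size_polyC_leq1 // big_ord1 coefC.
Qed.

Lemma gpoly_scale1 : left_id 1 gpoly_scale.
Proof. by move=> m; rewrite gpoly_scaleC g1scale. Qed.

Lemma gpoly_scaleMX p m : gpoly_scale (p * 'X) m = gpoly_scale p (gshift m).
Proof.
rewrite (gpoly_scaleE (N := (size p).+1)); last first.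
  by rewrite (leq_trans (size_polyMleq _ _)) // size_polyX addn2.
rewrite big_ord_recl coefMX /= g0scale add0r; apply: eq_bigr => i _.
by rewrite coefMX /= -iterS iterSr.
Qed.

Lemma gpoly_scale_shift p m :
  gpoly_scale p (gshift m) = gshift (gpoly_scale p m).
Proof.
rewrite /gpoly_scale (big_morph _ gshiftD gshift0); apply: eq_bigr => i _.
by rewrite -iterSr iterS gshift_scale.
Qed.

Lemma gpoly_scaleZ c p m : gpoly_scale (c *: p) m = gscale c (gpoly_scale p m).
Proof.
rewrite (gpoly_scaleE (N := size p)) ?size_scale_leq // gscale_sum.
by apply: eq_bigr => i _; rewrite coefZ gscaleA.
Qed.

Lemma gpoly_scaleA p q m :
  gpoly_scale p (gpoly_scale q m) = gpoly_scale (p * q) m.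
Proof.
elim/poly_ind: p q m => [|p c IHp] q m.
  by rewrite mul0r -(polyC0 F) !gpoly_scaleC !g0scale.
rewrite gpoly_scaleDl gpoly_scaleC gpoly_scaleMX -gpoly_scale_shift.
rewrite -gpoly_scaleMX IHp mulrDl gpoly_scaleDl mul_polyC gpoly_scaleZ.
by rewrite -!mulrA ['X * q]mulrC.
Qed.

HB.instance Definition _ := GRing.Zmodule_isLmodule.Build {poly F} gradedmod
  gpoly_scaleA gpoly_scale1 gpoly_scaleDr gpoly_scaleDl.

Lemma gscaleX (m : gradedmod) : 'X *: m = gshift m.
Proof.
rewrite -[X in X *: _]mul1r [LHS]gpoly_scaleMX; exact: gpoly_scale1.
Qed.

End GradedModule.

Section GradedMap.
Variables (F : fieldType) (P Q : persmod F) (f : forall u, {linear P u -> Q u}).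

Lemma gmap_subproof (m : gradedmod P) :
  exists N, forall u, (N <= u)%N -> f u (m u) = 0.
Proof.
by have [N mN] := gcomp_fin m; exists N => u /mN ->; rewrite linear0.
Qed.

Definition gmap (m : gradedmod P) : gradedmod Q := GradedMod (gmap_subproof m).

Lemma gmap_linear :
  (forall u h, f u.+1 (pers_map P u h) = pers_map Q u (f u h)) -> linear gmap.
Proof.
move=> f_comm p m n.
have gmapD : {morph gmap : m n / m + n}.
  by move=> a b; apply: gradedmod_eq => u; exact: linearD.
have gmap0 : gmap 0 = 0 by apply: gradedmod_eq => u; exact: linear0.
have gmap_shift i a :
    gmap (iter i (@gshift F P) a) = iter i (@gshift F Q) (gmap a).
  elim: i => [//|i IHi]; rewrite !iterS -IHi.
  by apply: gradedmod_eq => -[|u] /=; rewrite ?linear0 ?f_comm.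
rewrite gmapD; congr (_ + _).
rewrite [LHS](big_morph _ gmapD gmap0); apply: eq_bigr => i _.
by rewrite -gmap_shift; apply: gradedmod_eq => u; exact: linearZ.
Qed.

End GradedMap.

Record filtration (X : topologicalType) := Filtration {
  fil :> nat -> set X;
  fil_mono : forall u, fil u `<=` fil u.+1 }.

Section Sublevel.
Variables (R : realType) (X : topologicalType) (phi : X -> R).
Variables (n : nat) (r : nat -> R).
Hypothesis r_incr : forall u v, (u < v <= n)%N -> r u < r v.

(* Only the values [r 0 < ... < r n] matter: [X_u = X] beyond [n]. *)
Definition sublevel (u : nat) : set X :=
  if (u <= n)%N then [set x | phi x <= r u] else setT.

Lemma sublevel_mono u : sublevel u `<=` sublevel u.+1.
Proof.
rewrite /sublevel; case: ifP => // un; case: ifP => // u1n x /= xu.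
  by apply: le_trans xu _; rewrite ltW // r_incr // leqnn.
by rewrite (ltnW u1n) in un.
Qed.

Definition sublevel_filtration : filtration X := Filtration sublevel_mono.

End Sublevel.

Section MayerVietoris.
Variables (R : realType) (F : fieldType) (X : topologicalType).
Variable (Xf : filtration X).

Definition level (Y : set X) (u : nat) : set X := Y `&` Xf u.

Definition level_space (Y : set X) (u : nat) : topologicalType :=
  set_type (level Y u).

Lemma level_mono Y u : level Y u `<=` level Y u.+1.
Proof. by move=> x [Yx /fil_mono Xx]. Qed.

Lemma level_sub Y Z u : Y `<=` Z -> level Y u `<=` level Z u.
Proof. by move=> YZ x [/YZ Zx Xx]. Qed.

Definition level_incl Y Z (YZ : Y `<=` Z) u :
    continuousType (level_space Y u) (level_space Z u) :=
  incl (level_sub (u := u) YZ).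

Definition pers (k : int) (Y : set X) : persmod F :=
  PersMod (fun u => Hsing_map R F (incl (@level_mono Y u)) k).

Definition HH (k : int) (Y : set X) : lmodType {poly F} := gradedmod (pers k Y).

Lemma incl_comm Y Z (YZ : Y `<=` Z) k u (h : pers k Y u) :
  Hsing_map R F (level_incl YZ u.+1) k (pers_map (pers k Y) u h) =
  pers_map (pers k Z) u (Hsing_map R F (level_incl YZ u) k h).
Proof.
by rewrite -!Hsing_map_comp; apply: eq_Hsing_map => x; exact: val_inj.
Qed.

Variables A B : set X.

Definition s_level k u :
    {linear Hsing R F k (level_space (A `&` B) u) ->
            Hsing R F k (level_space A u)} :=
  Hsing_map R F (level_incl (@subIsetl _ A B) u) k.

Definition t_level k u :
    {linear Hsing R F k (level_space (A `&` B) u) ->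
            Hsing R F k (level_space B u)} :=
  -%R \o Hsing_map R F (level_incl (@subIsetr _ A B) u) k.

Definition beta_level k u
    (ab : (Hsing R F k (level_space A u) *
           Hsing R F k (level_space B u))%type) :
    Hsing R F k (level_space setT u) :=
  Hsing_map R F (level_incl (@subsetT _ A) u) k ab.1 +
  Hsing_map R F (level_incl (@subsetT _ B) u) k ab.2.

(* [d] is the Mayer-Vietoris connecting map of the triad [(X_u, A_u, B_u)]: it
   maps the class of a cycle [x = a + b], with [a] a chain in [A_u] and [b]
   a chain in [B_u], to the class of the chain [y] of [(A `&` B)_u] whose image
   in [A_u] is the boundary of [a]. *)
Definition is_connecting k u
    (d : {linear singular_homology R F k.+1 (level_space setT u) ->
                 singular_homology R F k (level_space (A `&` B) u)}) : Prop :=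
  forall (a : chains R F k.+1 (level_space A u))
         (b : chains R F k.+1 (level_space B u))
         (x : cycles (boundary R F k.+1 (level_space setT u)))
         (y : cycles (boundary R F k (level_space (A `&` B) u))),
    chain_of x = chain_map R F (level_incl (@subsetT _ A) u) k.+1 a +
                 chain_map R F (level_incl (@subsetT _ B) u) k.+1 b ->
    chain_map R F (level_incl (@subIsetl _ A B) u) k (chain_of y) =
      boundary R F k.+1 (level_space A u) a ->
    d (hclass _ _ x) = hclass _ _ y.

(* The only junk value is the zero map, returned when there is no map as above.
   When [X] is the union of the interiors of [A] and [B], such a map exists and
   is unique (small simplices theorem). *)
Definition connecting k u :
    {linear singular_homology R F k.+1 (level_space setT u) ->
            singular_homology R F k (level_space (A `&` B) u)} :=
  if pselect (exists d, is_connecting (k := k) (u := u) d) is left dP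
  then projT1 (cid dP) else \0.

Definition delta_level (k : int) u :
    {linear Hsing R F (1 + k) (level_space setT u) ->
            Hsing R F k (level_space (A `&` B) u)} :=
  if k is Posz k' then connecting k' u else \0.

Definition delta k : HH (1 + k) setT -> HH k (A `&` B) :=
  @gmap F (pers (1 + k) setT) (pers k (A `&` B)) (delta_level k).

Definition alpha_fun k (y : HH k (A `&` B)) : (HH k A * HH k B)%type :=
  (@gmap F (pers k (A `&` B)) (pers k A) (s_level k) y,
   @gmap F (pers k (A `&` B)) (pers k B) (t_level k) y).

Lemma alpha_linear k : linear (@alpha_fun k).
Proof.
move=> p y z; congr pair.
  by apply: gmap_linear => u h; exact: incl_comm.
by apply: gmap_linear => u h /=; rewrite linearN; congr (- _); exact: incl_comm.
Qed.

Definition alpha k : {linear HH k (A `&` B) -> (HH k A * HH k B)%type} :=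
  HB.pack (@alpha_fun k) (GRing.isLinear.Build _ _ _ _ _ (@alpha_linear k)).

Lemma beta_fin k (ab : (HH k A * HH k B)%type) :
  exists N, forall u, (N <= u)%N -> @beta_level k u (ab.1 u, ab.2 u) = 0.
Proof.
have [[N aN] [M bM]] := (gcomp_fin ab.1, gcomp_fin ab.2).
exists (maxn N M) => u; rewrite geq_max => /andP[/aN au /bM bu].
by rewrite /beta_level /= au bu !linear0 addr0.
Qed.

Definition beta_fun k (ab : (HH k A * HH k B)%type) : HH k setT :=
  @GradedMod F (pers k setT) _ (beta_fin ab).

Lemma beta_linear k : linear (@beta_fun k).
Proof.
pose iA := @gmap F (pers k A) (pers k setT)
  (fun u => Hsing_map R F (level_incl (@subsetT _ A) u) k).
pose iB := @gmap F (pers k B) (pers k setT)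
  (fun u => Hsing_map R F (level_incl (@subsetT _ B) u) k).
have iA_lin : linear iA by apply: gmap_linear => u h; exact: incl_comm.
have iB_lin : linear iB by apply: gmap_linear => u h; exact: incl_comm.
have betaE ab : beta_fun ab = iA ab.1 + iB ab.2 by exact: gradedmod_eq.
move=> p ab cd; rewrite !betaE iA_lin iB_lin scalerDr addrACA //.
Qed.

Definition beta k : {linear (HH k A * HH k B)%type -> HH k setT} :=
  HB.pack (@beta_fun k) (GRing.isLinear.Build _ _ _ _ _ (@beta_linear k)).

End MayerVietoris.

Arguments sublevel {R X} phi n r u.
Arguments sublevel_filtration {R X} phi {n r} r_incr.
Arguments HH R F {X} Xf k Y.
Arguments delta R F {X} Xf A B k.
Arguments alpha R F {X} Xf A B k.
Arguments beta R F {X} Xf A B k.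

(* Main.v *)
From HB Require Import structures.
Require Import Defs.
From mathcomp Require Import all_boot all_order all_algebra.
From mathcomp Require Import all_classical.
From mathcomp Require Import reals topology normedtype sequences.
From mathcomp Require Import freeg.
From mathcomp Require Import lra.

Set Implicit Arguments.
Unset Strict Implicit.
Unset Printing Implicit Defensive.

Import Order.TTheory GRing.Theory Num.Theory numFieldNormedType.Exports.

Local Open Scope classical_set_scope.
Local Open Scope ring_scope.

(** The graded sequence is exact because it is exact at every level. The
    homomorphisms act level by level, so membership in a kernel or an image is
    a condition on each component; preimages chosen at the separate levels,
    and chosen to be zero where the target is zero, again have finite support
    ([gradedmod_choice]). That [delta] is linear over F[x] amounts to the
    naturality of the connecting map for the inclusion of one level in the next
    ([connecting_natural]).

    At one level this is the classical Mayer-Vietoris theorem. Call a chain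
    small when it is a sum of a chain in A and a chain in B. Chains of A and
    chains of B with the same image come from a unique chain of the
    intersection, so for the complex of small chains the exact sequence is a
    diagram chase. What makes the chase apply to the whole space is that every
    cycle is homologous to a small one, and that a small cycle which bounds
    also bounds a small chain ([small_cycle], [small_boundary]); the section on
    triads derives the connecting map and the exactness from these facts alone.

    Small chains are reached by iterated barycentric subdivision. The
    combinatorics takes place in the augmented complex spanned by finite
    sequences of points, in all degrees at once. With b.c denoting the cone of
    c with apex b, one has d(b.c) = c - b.(dc) without exception in low degrees.
    The homotopy is T s = b.(s - T(ds)), where b is the barycenter of s, and
    subdivision is defined to be 1 - dT - Td. It is then a chain map homotopic
    to the identity by construction, and it satisfies Sd s = b.Sd(ds)
    ([subdivisionE]). The last formula yields the geometric estimate: the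
    pieces of a k-simplex are smaller by the factor 1 - 1/(k+1)
    ([subdivision_pieces]). Sequences of points of a standard simplex are
    realized as affine simplices, and a natural operator on sequences acts on a
    singular simplex s by applying s to the realization of its value on the
    vertices ([singular_op]). Since the standard simplex is compact, a high
    iterate maps a given chain to a small one ([subdivision_small_chain]). *)

(** * Free modules *)

Section FreeModules.
Variables (F : fieldType).
Implicit Types K : choiceType.

Lemma fgliftU1 K (M : lmodType F) (f : K -> M) x : fglift f << x >> = f x.
Proof. by rewrite liftU scale1r. Qed.

Lemma freeg_sum_scale K (c : {freeg K / F}) :
  c = \sum_(x <- dom c) coeff x c *: << x >>.
Proof.
by rewrite -[LHS]freeg_sumE; apply: eq_bigr => x _; rewrite -freegU_scale.
Qed.

Definition supported K (Q : K -> Prop) (c : {freeg K / F}) : Prop :=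
  forall x, x \in dom c -> Q x.

Lemma eq_linear_supported K (M : lmodType F)
    (f g : {linear {freeg K / F} -> M}) (c : {freeg K / F}) :
  supported (fun x => f << x >> = g << x >>) c -> f c = g c.
Proof.
move=> fg; have cE := freeg_sum_scale c.
have fE (h : {linear {freeg K / F} -> M}) :
    h c = \sum_(x <- dom c) coeff x c *: h << x >>.
  by rewrite {1}cE linear_sum; apply: eq_bigr => x _; rewrite linearZ.
by rewrite !fE !big_seq; apply: eq_bigr => x /fg ->.
Qed.

Lemma eq_linear_freeg K (M : lmodType F) (f g : {linear {freeg K / F} -> M}) :
  (forall x, f << x >> = g << x >>) -> f =1 g.
Proof. by move=> fg c; apply: eq_linear_supported => x _. Qed.

Lemma eq_fglift K (M : lmodType F) (f g : K -> M) (c : {freeg K / F}) :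
  supported (fun x => f x = g x) c -> fglift f c = fglift g c.
Proof.
by move=> fg; apply: eq_linear_supported => x /fg; rewrite /= !fgliftU1.
Qed.

Section Supported.
Variables (K : choiceType) (Q : K -> Prop).

Lemma supported0 : supported Q (0 : {freeg K / F}).
Proof. by move=> x; rewrite dom0. Qed.

Lemma supportedU x : Q x -> supported Q (<< x >> : {freeg K / F}).
Proof. by move=> Qx y; rewrite domU1 inE => /eqP ->. Qed.

Lemma supportedD (c e : {freeg K / F}) :
  supported Q c -> supported Q e -> supported Q (c + e).
Proof.
by move=> Qc Qe x /domD_subset; rewrite mem_cat => /orP[/Qc|/Qe].
Qed.

Lemma supportedZ a (c : {freeg K / F}) :
  supported Q c -> supported Q (a *: c).
Proof. by move=> Qc x /domZ_subset /Qc. Qed.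

Lemma supportedN (c : {freeg K / F}) : supported Q c -> supported Q (- c).
Proof. by rewrite -scaleN1r; exact: supportedZ. Qed.

Lemma supported_fglift K' (f : K' -> {freeg K / F}) (c : {freeg K' / F}) :
  supported (fun x => supported Q (f x)) c -> supported Q (fglift f c).
Proof.
move=> Qc; rewrite [c]freeg_sum_scale linear_sum /= big_seq.
apply: (big_ind (supported Q)) => [||x xc]; first exact: supported0.
  exact: supportedD.
by rewrite linearZ /= fgliftU1; apply: supportedZ; exact: Qc.
Qed.

Lemma supported_ind (S : {freeg K / F} -> Prop) (c : {freeg K / F}) :
  S 0 -> (forall u v, S u -> S v -> S (u + v)) ->
  (forall a u, S u -> S (a *: u)) ->
  supported (fun x => S << x >>) c -> S c.
Proof.
move=> S0 SD SZ Sc; rewrite [c]freeg_sum_scale big_seq.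
by apply: (big_ind S) => // x xc; apply: SZ; exact: Sc.
Qed.

Lemma supported_linear (M : lmodType F) (f : {linear {freeg K / F} -> M})
    (S : M -> Prop) (c : {freeg K / F}) :
  S 0 -> (forall u v, S u -> S v -> S (u + v)) ->
  (forall a u, S u -> S (a *: u)) ->
  supported (fun x => S (f << x >>)) c -> S (f c).
Proof.
move=> S0 SD SZ; apply: (supported_ind (S := fun c => S (f c))) => [|u v|a u].
- by rewrite linear0.
- by rewrite linearD; exact: SD.
- by rewrite linearZ; exact: SZ.
Qed.

Lemma sub_supported (Q' : K -> Prop) (c : {freeg K / F}) :
  supported Q c -> (forall x, Q x -> Q' x) -> supported Q' c.
Proof. by move=> Qc QQ' x /Qc /QQ'. Qed.

End Supported.
End FreeModules.

(** * Formal chains of point sequences and their subdivision *)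

Section LinearChains.
Variables (F : fieldType).
Implicit Types P Q : choiceType.

(** Sequences of all lengths are basis elements: a sequence of m+1 points has
    degree m, and the empty sequence is the generator in degree -1 that augments
    the complex. *)
Definition lchain P : lmodType F := {freeg (seq P) / F}.

Definition cone P (b : P) : lchain P -> lchain P :=
  fglift (fun s => << b :: s >>).

HB.instance Definition _ P (b : P) := GRing.Linear.on (cone b).

Lemma coneU P (b : P) s : cone b << s >> = << b :: s >>.
Proof. exact: fgliftU1. Qed.

Fixpoint seq_boundary P (s : seq P) : lchain P :=
  if s is v :: s' then << s' >> - cone v (seq_boundary s') else 0.

Definition lboundary P : lchain P -> lchain P := fglift (@seq_boundary P).

HB.instance Definition _ P := GRing.Linear.on (@lboundary P).

Lemma lboundaryU P (s : seq P) : lboundary << s >> = seq_boundary s.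
Proof. exact: fgliftU1. Qed.

(** Since the boundary is defined by recursion on the first point, the cone
    formula holds by definition, also for the empty sequence: this is what the
    augmentation is for. *)
Lemma lboundary_cone P (b : P) (c : lchain P) :
  lboundary (cone b c) = c - cone b (lboundary c).
Proof.
apply: (eq_linear_freeg (f := @lboundary P \o cone b)
  (g := idfun - (cone b \o @lboundary P))) => s.
by rewrite /= coneU !lboundaryU.
Qed.

Lemma lboundaryK P (c : lchain P) : lboundary (lboundary c) = 0.
Proof.
apply: (eq_linear_freeg (f := @lboundary P \o @lboundary P) (g := \0)) => s.
rewrite /= lboundaryU; elim: s => [|v s IHs] /=; first by rewrite linear0.
by rewrite linearB /= lboundary_cone IHs linear0 subr0 lboundaryU subrr.
Qed.

Lemma size_seq_boundary P (s : seq P) :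
  supported (fun t => size t = (size s).-1) (seq_boundary s).
Proof.
elim: s => [|v s IHs] /=; first exact: supported0.
apply: supportedD; first exact: supportedU.
apply: supportedN; apply: supported_fglift; case: s IHs => [|w s] IHs.
  exact: supported0.
by apply: (sub_supported IHs) => t st; apply: supportedU; rewrite /= st.
Qed.

(** The subdivision of a face is estimated with the bounds known for the whole
    sequence. *)
Lemma seq_boundary_sub P (s : seq P) :
  supported (fun t : seq P => {subset t <= s}) (seq_boundary s).
Proof.
elim: s => [|v s IHs] /=; first exact: supported0.
apply: supportedD.
  by apply: supportedU => w ws; rewrite inE ws orbT.
apply: supportedN; apply: supported_fglift; apply: (sub_supported IHs) => t ts.
apply: supportedU => w; rewrite !inE => /orP[->//|/ts ->]; exact: orbT.
Qed.

Definition omit T (i : nat) (s : seq T) := take i s ++ drop i.+1 s.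

Lemma nth_omit T (x0 : T) i s j : (i <= size s)%N ->
  nth x0 (omit i s) j = nth x0 s (bump i j).
Proof.
move=> i_s; rewrite nth_cat size_takel // /bump.
case: ltnP => [ji|ij]; first by rewrite nth_take.
by rewrite nth_drop addSn subnKC.
Qed.

Lemma size_omit T i (s : seq T) :
  (i < size s)%N -> size (omit i s) = (size s).-1.
Proof.
move=> i_s; rewrite size_cat size_drop (size_takel (ltnW i_s)).
by rewrite subnS -(subn1 (_ - _)) addnBA ?subn_gt0 // subnKC ?subn1 // ltnW.
Qed.

(** The recursive boundary is the usual alternating sum of faces; this form is
    the one to compare with the singular boundary. *)
Lemma seq_boundaryE (P : choiceType) (s : seq P) :
  seq_boundary s = \sum_(i < size s) (-1) ^+ i *: << omit i s >>.
Proof.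
elim: s => [|v s IHs] /=; first by rewrite big_ord0.
rewrite big_ord_recl expr0 scale1r IHs linear_sum /= -sumrN.
rewrite [omit _ _](_ : _ = s); last by rewrite /omit /= drop0.
congr (_ + _); apply: eq_bigr => i _.
by rewrite linearZ /= coneU exprS mulN1r scaleNr.
Qed.

Definition lmap P Q (f : P -> Q) : lchain P -> lchain Q :=
  fglift (fun s => << map f s >>).

HB.instance Definition _ P Q (f : P -> Q) := GRing.Linear.on (lmap f).

Lemma lmapU P Q (f : P -> Q) s : lmap f << s >> = << map f s >>.
Proof. exact: fgliftU1. Qed.

Lemma lmap_cone P Q (f : P -> Q) b (c : lchain P) :
  lmap f (cone b c) = cone (f b) (lmap f c).
Proof.
apply: (eq_linear_freeg (f := lmap f \o cone b) (g := cone (f b) \o lmap f)).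
by move=> s; rewrite /= coneU !lmapU coneU.
Qed.

Lemma lmap_seq_boundary P Q (f : P -> Q) s :
  lmap f (seq_boundary s) = seq_boundary (map f s).
Proof.
elim: s => [|v s IHs] /=; first by rewrite linear0.
by rewrite linearB /= lmap_cone IHs lmapU.
Qed.

Lemma lmap_boundary P Q (f : P -> Q) (c : lchain P) :
  lmap f (lboundary c) = lboundary (lmap f c).
Proof.
apply: (eq_linear_freeg (f := lmap f \o @lboundary P)
  (g := @lboundary Q \o lmap f)) => s.
by rewrite /= lmapU !lboundaryU lmap_seq_boundary.
Qed.

Section Subdivision.
Variables (P : choiceType) (bary : seq P -> P).

(** T s = b.(s - T(ds)) calls itself on all faces of s, whence the recursion on
    the length [n], which is always used with [n = size s]. *)
Fixpoint seq_homotopy (n : nat) (s : seq P) : lchain P :=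
  if n is n'.+1 then
    cone (bary s) (<< s >> - fglift (seq_homotopy n') (seq_boundary s))
  else 0.

Definition homotopy : lchain P -> lchain P :=
  fglift (fun s => seq_homotopy (size s) s).

HB.instance Definition _ := GRing.Linear.on homotopy.

Lemma homotopyE s : s != [::] ->
  homotopy << s >> = cone (bary s) (<< s >> - homotopy (seq_boundary s)).
Proof.
case: s => // v s _; rewrite [LHS]fgliftU1 [seq_homotopy _ _]/=.
congr (cone _ (_ - _)); apply: eq_fglift => t tb.
by rewrite (size_seq_boundary (s := v :: s) tb).
Qed.

Lemma homotopy_nil : homotopy << [::] >> = 0.
Proof. exact: fgliftU1. Qed.

Definition subdivision (c : lchain P) : lchain P :=
  c - lboundary (homotopy c) - homotopy (lboundary c).

Lemma subdivision_linear : linear subdivision.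
Proof.
move=> a c e; rewrite /subdivision !linearP /= !scalerDr.
by rewrite (addrACA (a *: c)) [LHS]addrACA.
Qed.

HB.instance Definition _ :=
  GRing.isLinear.Build F (lchain P) (lchain P) _ subdivision subdivision_linear.

Lemma subdivision_nil : subdivision << [::] >> = << [::] >>.
Proof. by rewrite /subdivision homotopy_nil lboundaryU /= !linear0 !addr0. Qed.

Lemma subdivision_boundary c :
  subdivision (lboundary c) = lboundary (subdivision c).
Proof. by rewrite /subdivision !linearB /= !lboundaryK !linear0 !addr0. Qed.

(** With T s = b.(s - T(ds)), the cone formula and dd = 0 give
    s - dT s - T(ds) = b.(ds - dT(ds)), and the argument of the cone is Sd(ds)
    as T(dds) = 0. *)
Lemma subdivisionE s : s != [::] ->
  subdivision << s >> = cone (bary s) (subdivision (seq_boundary s)).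
Proof.
move=> s0; rewrite /subdivision homotopyE // lboundary_cone linearB /=.
rewrite !lboundaryU.
rewrite -(lboundaryU s) lboundaryK; set h := homotopy _.
rewrite linear0 subr0 [lboundary (_ - h)]linearB opprB opprK addrA.
rewrite [_ + (h - _)]addrC subrK.
by rewrite addrAC subrr add0r.
Qed.

Lemma iter_subdivision_linear m : linear (iter m subdivision).
Proof. by elim: m => // m IHm a c e; rewrite !iterS IHm linearP. Qed.

HB.instance Definition _ m := GRing.isLinear.Build F (lchain P) (lchain P) _
  (iter m subdivision) (iter_subdivision_linear m).

Lemma iter_subdivision_nil m :
  iter m subdivision << [::] >> = << [::] >>.
Proof. by elim: m => //= m ->; exact: subdivision_nil. Qed.

Definition iter_homotopy m (c : lchain P) : lchain P :=
  \sum_(i < m) homotopy (iter i subdivision c).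

Lemma iter_homotopy_linear m : linear (iter_homotopy m).
Proof.
move=> a c e; rewrite /iter_homotopy scaler_sumr -big_split.
by apply: eq_bigr => i _; rewrite !linearP.
Qed.

HB.instance Definition _ m := GRing.isLinear.Build F (lchain P) (lchain P) _
  (iter_homotopy m) (iter_homotopy_linear m).

Lemma iter_subdivision_boundary m c :
  iter m subdivision (lboundary c) = lboundary (iter m subdivision c).
Proof. by elim: m => //= m IHm; rewrite IHm subdivision_boundary. Qed.

(** The sum telescopes: each iterate of the subdivision differs from the next
    one by the homotopy formula applied to that iterate. *)
Lemma iter_homotopyP m c :
  lboundary (iter_homotopy m c) + iter_homotopy m (lboundary c) =
  c - iter m subdivision c.
Proof.
elim: m => [|m IHm].
  by rewrite /iter_homotopy !big_ord0 linear0 addr0 subrr.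
have iterD e : iter_homotopy m.+1 e =
    iter_homotopy m e + homotopy (iter m subdivision e).
  exact: big_ord_recr.
rewrite !iterD linearD addrACA IHm iter_subdivision_boundary iterS.
rewrite /subdivision -[iter _ _ c]/(iter m subdivision c).
set e := iter m subdivision c.
rewrite [_ + homotopy _](_ : _ = e - (e - lboundary (homotopy e)
  - homotopy (lboundary e))); first by rewrite addrA subrK.
by rewrite -[e - _ - _]addrA -opprD subKr.
Qed.

End Subdivision.

(** T is built from cones with apex the barycenter and from faces, so it is
    natural for maps of points that preserve barycenters. The condition concerns
    nonempty sequences because T vanishes on the empty one. *)
Lemma lmap_homotopy P Q (bP : seq P -> P) (bQ : seq Q -> Q) (f : P -> Q) :
  (forall s, s != [::] -> f (bP s) = bQ (map f s)) ->
  forall c, lmap f (homotopy bP c) = homotopy bQ (lmap f c).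
Proof.
move=> fb c; apply: (eq_linear_freeg (f := lmap f \o homotopy bP)
  (g := homotopy bQ \o lmap f)) => s /=.
rewrite lmapU; have [n] := ubnP (size s); elim: n s => // n IHn s sn.
have [->|s0] := eqVneq s [::]; first by rewrite /= !homotopy_nil linear0.
rewrite !homotopyE //; last by case: s s0 {sn}.
rewrite lmap_cone fb // linearB /= lmapU -lmap_seq_boundary.
congr (cone _ (_ - _)).
have: supported (fun t : seq P => (size t < n)%N) (seq_boundary s).
  apply: (sub_supported (size_seq_boundary (s := s))) => t ->.
  by case: s s0 sn.
move=> bs; apply: (eq_linear_supported (f := lmap f \o homotopy bP)
  (g := homotopy bQ \o lmap f)) => t /bs /IHn /= ->.
by rewrite lmapU.
Qed.

Lemma lmap_subdivision P Q (bP : seq P -> P) (bQ : seq Q -> Q) (f : P -> Q) :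
  (forall s, s != [::] -> f (bP s) = bQ (map f s)) ->
  forall c, lmap f (subdivision bP c) = subdivision bQ (lmap f c).
Proof.
move=> fb c; rewrite /subdivision !linearB /= lmap_boundary !(lmap_homotopy fb).
by rewrite lmap_boundary.
Qed.

Lemma lmap_iter_subdivision P Q (bP : seq P -> P) (bQ : seq Q -> Q)
    (f : P -> Q) :
  (forall s, s != [::] -> f (bP s) = bQ (map f s)) ->
  forall m c, lmap f (iter m (subdivision bP) c) =
              iter m (subdivision bQ) (lmap f c).
Proof.
by move=> fb; elim=> // m IHm c; rewrite !iterS -IHm (lmap_subdivision fb).
Qed.

Lemma lmap_iter_homotopy P Q (bP : seq P -> P) (bQ : seq Q -> Q)
    (f : P -> Q) :
  (forall s, s != [::] -> f (bP s) = bQ (map f s)) ->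
  forall m c, lmap f (iter_homotopy bP m c) = iter_homotopy bQ m (lmap f c).
Proof.
move=> fb m c; rewrite linear_sum; apply: eq_bigr => i _ /=.
by rewrite (lmap_homotopy fb) (lmap_iter_subdivision fb).
Qed.

End LinearChains.

(** * Affine simplices and natural operators on singular chains *)

Section AffineSimplices.
Variable R : realType.
Local Notation simplex := (simplex R).

Definition bcoord k (p : simplex k) (j : 'I_k.+1) : R := set_val p ord0 j.

Lemma bcoord_ge0 k (p : simplex k) j : 0 <= bcoord p j.
Proof. by have [p0 _] := set_valP p; exact: p0. Qed.

Lemma sum_bcoord k (p : simplex k) : \sum_j bcoord p j = 1.
Proof. by have [_ p1] := set_valP p. Qed.

Lemma simplex_eq k (p q : simplex k) : bcoord p =1 bcoord q -> p = q.
Proof.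
by move=> pq; apply: val_inj; apply/rowP => j; exact: pq.
Qed.

Lemma bcoord_continuous k (j : 'I_k.+1) :
  continuous (fun p : simplex k => bcoord p j).
Proof.
move=> p; apply: (@continuous_comp (simplex k) 'rV[R]_k.+1 R set_val
  (fun M : 'rV[R]_k.+1 => M ord0 j)).
  exact: initial_continuous.
exact: matrix_normedtype.coord_continuous.
Qed.

Lemma vertex_subproof k (i : 'I_k.+1) :
  std_simplex (delta_mx ord0 i : 'rV[R]_k.+1).
Proof.
split=> [j|]; first by rewrite mxE ler0n.
rewrite (bigD1 i) //= mxE !eqxx big1 ?addr0 // => j ji.
by rewrite mxE (negbTE ji) andbF.
Qed.

Definition vertex k (i : 'I_k.+1) : simplex k :=
  SigSub (mem_set (vertex_subproof i)).

Lemma bcoord_vertex k (i j : 'I_k.+1) : bcoord (vertex i) j = (j == i)%:R.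
Proof. by rewrite /bcoord mxE eqxx. Qed.

Definition vertices k : seq (simplex k) := [seq vertex i | i <- enum 'I_k.+1].

Lemma size_vertices k : size (vertices k) = k.+1.
Proof. by rewrite size_map size_enum_ord. Qed.

Local Notation point s i := (nth (vertex ord0) s i).

Lemma nth_vertices k (i : 'I_k.+1) : point (vertices k) i = vertex i.
Proof. by rewrite (nth_map ord0) ?size_enum_ord // nth_ord_enum. Qed.

Lemma comb_subproof m k (s : seq (simplex k)) (t : simplex m) :
  std_simplex (\row_j \sum_i bcoord t i * bcoord (point s i) j).
Proof.
split=> [j|].
  by rewrite mxE sumr_ge0 // => i _; rewrite mulr_ge0 ?bcoord_ge0.
under eq_bigr do rewrite mxE.
rewrite exchange_big -[RHS](sum_bcoord t); apply: eq_bigr => i _.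
by rewrite -mulr_sumr sum_bcoord mulr1.
Qed.

(** The default value of [nth] makes the combination a point of the simplex for
    every length of [s]; it is meaningful when [s] has [m.+1] points. *)
Definition comb m k (s : seq (simplex k)) (t : simplex m) : simplex k :=
  SigSub (mem_set (comb_subproof s t)).

Lemma bcoord_comb m k (s : seq (simplex k)) (t : simplex m) j :
  bcoord (comb s t) j = \sum_i bcoord t i * bcoord (point s i) j.
Proof. by rewrite /bcoord [LHS]mxE. Qed.

Lemma continuous_sum (T : topologicalType) (I : Type) (r : seq I)
    (f : I -> T -> R) :
  (forall i, continuous (f i)) -> continuous (fun x => \sum_(i <- r) f i x).
Proof.
move=> fc; elim: r => [|i r IHr].
  rewrite (_ : (fun _ => _) = fun=> 0); first exact: cst_continuous.
  by apply/funext => x; rewrite big_nil.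
rewrite (_ : (fun _ => _) = fun x => f i x + \sum_(j <- r) f j x).
  by move=> x; apply: (@continuousD R R T (f i)); [exact: fc|exact: IHr].
by apply/funext => x; rewrite big_cons.
Qed.

Lemma comb_continuous m k (s : seq (simplex k)) :
  continuous (comb s : simplex m -> simplex k).
Proof.
apply: continuous_comp_initial; apply: continuous_mx => a j.
rewrite (_ : (fun _ => _) = fun t : simplex m =>
    \sum_i bcoord t i * bcoord (point s i) j); last first.
  by apply/funext => t; rewrite ord1; exact: bcoord_comb.
apply: continuous_sum => i t.
apply: (@continuousM R (simplex m)); first exact: bcoord_continuous.
exact: cst_continuous.
Qed.

Definition affine m k (s : seq (simplex k)) :
  continuousType (simplex m) (simplex k) := mkcts (@comb_continuous m k s).

Lemma comb_vertices k (t : simplex k) : comb (vertices k) t = t.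
Proof.
apply: simplex_eq => j; rewrite bcoord_comb (bigD1 j) //= big1 => [|i ij].
  by rewrite nth_vertices bcoord_vertex eqxx mulr1 addr0.
by rewrite nth_vertices bcoord_vertex eq_sym (negbTE ij) mulr0.
Qed.

Lemma bcoord_face k (i : 'I_k.+2) (p : simplex k) j :
  bcoord (face_fun i p) j = oapp (bcoord p) 0 (unlift i j).
Proof. by rewrite /bcoord [LHS]mxE. Qed.

(** Faces are affine maps. *)
Lemma face_comb m k (i : 'I_k.+2) (s : seq (simplex k)) (t : simplex m) :
  size s = m.+1 -> face_fun i (comb s t) = comb (map (face_fun i) s) t.
Proof.
move=> sm; apply: simplex_eq => j; rewrite bcoord_face bcoord_comb.
under eq_bigr => l _ do
  rewrite (nth_map (vertex ord0)) ?sm ?ltn_ord // bcoord_face.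
case: unlift => [j'|] /=; first by rewrite bcoord_comb.
by rewrite big1 // => l _; rewrite mulr0.
Qed.

Lemma comb_face m k (i : 'I_m.+2) (s : seq (simplex k)) (t : simplex m) :
  size s = m.+2 -> comb s (face_fun i t) = comb (omit i s) t.
Proof.
move=> sm; apply: simplex_eq => j; rewrite !bcoord_comb (bigD1_ord i) //=.
rewrite bcoord_face unlift_none mul0r add0r; apply: eq_bigr => l _.
by rewrite bcoord_face liftK nth_omit // sm ltnW.
Qed.

Lemma vertices_face k (i : 'I_k.+2) :
  map (face_fun i) (vertices k) = omit i (vertices k.+1).
Proof.
have sz : size (omit i (vertices k.+1)) = k.+1.
  rewrite size_cat size_drop size_takel size_vertices ?(ltnW (ltn_ord i)) //.
  by rewrite subSS subnKC // -ltnS.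
apply: (@eq_from_nth _ (vertex ord0)) => [|j].
  by rewrite size_map size_vertices sz.
rewrite size_map size_vertices => jk.
rewrite (nth_map (vertex ord0)) ?size_vertices // nth_omit; last first.
  by rewrite size_vertices ltnW.
rewrite (nth_vertices (Ordinal jk)).
rewrite (nth_vertices (fintype.lift i (Ordinal jk))).
apply: simplex_eq => l; rewrite bcoord_face bcoord_vertex.
case: unliftP => [l' ->|->] /=.
  by rewrite bcoord_vertex (inj_eq lift_inj).
by rewrite (negbTE (neq_lift _ _)).
Qed.

Lemma centroid_subproof m : std_simplex (\row_(j < m.+1) (m.+1%:R^-1 : R)).
Proof.
split=> [j|]; first by rewrite mxE invr_ge0 ler0n.
under eq_bigr do rewrite mxE.
by rewrite sumr_const card_ord -[LHS]mulr_natl mulfV // pnatr_eq0.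
Qed.

Definition centroid m : simplex m := SigSub (mem_set (centroid_subproof m)).

Lemma bcoord_centroid m j : bcoord (centroid m) j = m.+1%:R^-1.
Proof. by rewrite /bcoord mxE. Qed.

(** For the empty sequence this is the default vertex. *)
Definition barycenter k (s : seq (simplex k)) : simplex k :=
  comb s (centroid (size s).-1).

Lemma face_barycenter k (i : 'I_k.+2) (s : seq (simplex k)) : s != [::] ->
  face_fun i (barycenter s) = barycenter (map (face_fun i) s).
Proof.
move=> s0; rewrite /barycenter size_map face_comb //.
by rewrite prednK // lt0n size_eq0.
Qed.

Variable F : fieldType.

(** Sequences of the wrong length are sent to 0; this is consistent with the
    boundary, which lowers the length by one. *)
Definition realize m k : lchain F (simplex k) -> chains R F m (simplex k) :=
  fglift (fun s => if size s == m.+1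
    then << affine m s : singular_simplex R m (simplex k) >> else 0).

HB.instance Definition _ m k := GRing.Linear.on (@realize m k).

Lemma realizeU m k (s : seq (simplex k)) : realize m << s >> =
  if size s == m.+1 then << affine m s : singular_simplex R m (simplex k) >>
  else 0.
Proof. exact: fgliftU1. Qed.

Lemma boundaryU m (Y : topologicalType) (s : singular_simplex R m.+1 Y) :
  boundary R F m.+1 Y << s >> =
  \sum_(i < m.+2) (-1) ^+ i *: << (s \o face R i : singular_simplex R m Y) >>.
Proof.
rewrite /= fgliftU1; apply: eq_bigr => i _; exact: freegU_scale.
Qed.

(** The i-th face of an affine simplex is the affine simplex on the points
    other than the i-th one. *)
Lemma realize_boundary m k (c : lchain F (simplex k)) :
  boundary R F m.+1 (simplex k) (realize m.+1 c) = realize m (lboundary c).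
Proof.
apply: (eq_linear_freeg
  (f := boundary R F m.+1 (simplex k) \o @realize m.+1 k)
  (g := @realize m k \o @lboundary F (simplex k))) => s.
rewrite -[LHS]/(boundary R F m.+1 _ (realize _ _)).
rewrite -[RHS]/(realize _ (lboundary _)) realizeU lboundaryU seq_boundaryE.
rewrite linear_sum.
case: eqP => [sm|sm]; last first.
  rewrite linear0 big1 // => i _; rewrite linearZ /= realizeU size_omit //.
  case: eqP => [si|_]; last by rewrite scaler0.
  by case: sm; rewrite -si prednK // (leq_trans _ (ltn_ord i)).
rewrite boundaryU sm; apply: eq_bigr => i _.
rewrite linearZ /= realizeU size_omit ?sm // eqxx; congr (_ *: << _ >>).
by apply/continuousEP => t; exact: comb_face.
Qed.

Lemma chain_mapU (Y Z : topologicalType) (f : continuousType Y Z) k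
    (s : singular_simplex R k Y) :
  chain_map R F f k << s >> = << (f \o s : singular_simplex R k Z) >>.
Proof. exact: fgliftU1. Qed.

Lemma realize_face m k (i : 'I_k.+2) (c : lchain F (simplex k)) :
  chain_map R F (face R i) m (realize m c) =
  realize m (lmap (face_fun i) c).
Proof.
apply: (eq_linear_freeg (f := chain_map R F (face R i) m \o @realize m k)
  (g := @realize m k.+1 \o lmap (face_fun i))) => s.
rewrite -[LHS]/(chain_map R F _ m (realize _ _)).
rewrite -[RHS]/(realize _ (lmap _ _)) lmapU !realizeU size_map.
case: eqP => [sm|_]; last exact: linear0.
rewrite chain_mapU; congr << _ >>.
by apply/continuousEP => t; exact: face_comb.
Qed.

(** A singular simplex is the image of the sequence of vertices. This turns
    identities between chains of sequences into identities of singular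
    chains. *)
Lemma realize_vertices k (Y : topologicalType) (s : singular_simplex R k Y) :
  chain_map R F s k (realize k << vertices k >>) = << s >>.
Proof.
rewrite realizeU size_vertices eqxx chain_mapU; congr << _ >>.
by apply/continuousEP => t; rewrite /= [mkcts _ _]comb_vertices.
Qed.

Section SingularOperator.
Variable Phi : forall k, {linear lchain F (simplex k) -> lchain F (simplex k)}.
Hypothesis Phi_face : forall k (i : 'I_k.+2) c,
  lmap (face_fun i) (Phi k c) = Phi k.+1 (lmap (face_fun i) c).

(** This is the method of acyclic models: the value on the universal simplex,
    carried along by the singular simplex. *)
Definition singular_op k m (Y : topologicalType) :
    chains R F k Y -> chains R F m Y :=
  fglift (fun s : singular_simplex R k Y =>
    chain_map R F s m (realize m (Phi k << vertices k >>))).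

HB.instance Definition _ k m Y := GRing.Linear.on (@singular_op k m Y).

Lemma singular_opU k m Y (s : singular_simplex R k Y) :
  singular_op m << s >> =
  chain_map R F s m (realize m (Phi k << vertices k >>)).
Proof. exact: fgliftU1. Qed.

Lemma singular_op_natural k m (Y Z : topologicalType) (f : continuousType Y Z)
    (c : chains R F k Y) :
  chain_map R F f m (singular_op m c) = singular_op m (chain_map R F f k c).
Proof.
apply: (eq_linear_freeg (f := chain_map R F f m \o @singular_op k m Y)
  (g := @singular_op k m Z \o chain_map R F f k)) => s.
rewrite -[LHS]/(chain_map R F f m (singular_op _ _)).
rewrite -[RHS]/(singular_op _ (chain_map R F f k _)).
by rewrite chain_mapU !singular_opU chain_map_comp.
Qed.

(** The faces of [s] are its composites with the face inclusions, whose effect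
    on the universal value is moved inside [Phi] by naturality; together they
    make up the boundary of the sequence of vertices. *)
Lemma singular_op_boundary k m Y (s : singular_simplex R k.+1 Y) :
  singular_op m (boundary R F k.+1 Y << s >>) =
  chain_map R F s m (realize m (Phi k.+1 (lboundary << vertices k.+1 >>))).
Proof.
rewrite boundaryU lboundaryU seq_boundaryE size_vertices !linear_sum.
apply: eq_bigr => i _; rewrite !linearZ; congr (_ *: _).
rewrite [LHS]singular_opU chain_map_comp realize_face Phi_face lmapU.
by rewrite vertices_face.
Qed.

End SingularOperator.

(** The form of [chain_map_boundary] in positive degrees, free of [.-1]. *)
Lemma boundary_chain_map k (Y Z : topologicalType) (f : continuousType Y Z)
    (c : chains R F k.+1 Y) :
  boundary R F k.+1 Z (chain_map R F f k.+1 c) =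
  chain_map R F f k (boundary R F k.+1 Y c).
Proof. exact: chain_map_boundary. Qed.

(** Inherited from the complex of sequences, since [s] is the image of its
    vertices. *)
Lemma boundaryK k Y (c : chains R F k.+1 Y) :
  boundary R F k Y (boundary R F k.+1 Y c) = 0.
Proof.
case: k c => [//|k] c.
apply: (eq_linear_freeg (f := boundary R F k.+1 Y \o boundary R F k.+2 Y)
  (g := \0)) => s.
rewrite -[LHS]/(boundary R F k.+1 Y (boundary R F k.+2 Y _)).
rewrite -realize_vertices.
rewrite chain_map_boundary [boundary _ _ _ _ (realize _ _)]realize_boundary.
rewrite chain_map_boundary [boundary _ _ _ _ (realize _ _)]realize_boundary.
by rewrite lboundaryK !linear0.
Qed.

Definition simplex_subdivision N k :
    {linear lchain F (simplex k) -> lchain F (simplex k)} :=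
  iter N (subdivision (@barycenter k)).

Definition simplex_homotopy N k :
    {linear lchain F (simplex k) -> lchain F (simplex k)} :=
  iter_homotopy (@barycenter k) N.

Definition singular_subdivision N k Y :
    {linear chains R F k Y -> chains R F k Y} :=
  singular_op (simplex_subdivision N) k (Y := Y).

Definition singular_homotopy N k Y :
    {linear chains R F k Y -> chains R F k.+1 Y} :=
  singular_op (simplex_homotopy N) k.+1 (Y := Y).

Lemma singular_homotopyP N k Y (c : chains R F k.+1 Y) :
  boundary R F k.+2 Y (singular_homotopy N k.+1 Y c) +
    singular_homotopy N k Y (boundary R F k.+1 Y c) =
  c - singular_subdivision N k.+1 Y c.
Proof.
suff HtU s : boundary R F k.+2 Y (singular_homotopy N k.+1 Y << s >>) +
    singular_homotopy N k Y (boundary R F k.+1 Y << s >>) =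
    << s >> - singular_subdivision N k.+1 Y << s >>.
  exact: (eq_linear_freeg (f := (boundary R F k.+2 Y \o
    singular_homotopy N k.+1 Y) \+ (singular_homotopy N k Y \o
    boundary R F k.+1 Y)) (g := idfun \- singular_subdivision N k.+1 Y) HtU c).
rewrite [X in _ + X]singular_op_boundary; last first.
  move=> j i e; exact: (lmap_iter_homotopy (@face_barycenter j i)).
rewrite [singular_homotopy _ _ _ _]singular_opU.
rewrite [singular_subdivision _ _ _ _]singular_opU chain_map_boundary.
rewrite [boundary _ _ _ _ (realize _ _)]realize_boundary.
have := iter_homotopyP (F := F) (@barycenter k.+1) N << vertices k.+1 >>.
move=> /(congr1 (fun e => chain_map R F s k.+1 (realize k.+1 e))).
by rewrite !linearD !linearN realize_vertices.
Qed.

(** In degree 0 the singular complex is not augmented, but the additional term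
    is T applied to the empty sequence, which is 0. *)
Lemma singular_homotopy0 N Y (c : chains R F 0 Y) :
  boundary R F 1 Y (singular_homotopy N 0 Y c) =
  c - singular_subdivision N 0 Y c.
Proof.
suff HtU s : boundary R F 1 Y (singular_homotopy N 0 Y << s >>) =
    << s >> - singular_subdivision N 0 Y << s >>.
  exact: (eq_linear_freeg (f := boundary R F 1 Y \o singular_homotopy N 0 Y)
    (g := idfun \- singular_subdivision N 0 Y) HtU c).
have Hnil : iter_homotopy (@barycenter 0) N (lboundary << vertices 0 >>) = 0
    :> lchain F _.
  have := size_vertices 0; case: (vertices 0) => [//|v [|//]] _.
  rewrite lboundaryU /= linear0 subr0 /iter_homotopy big1 // => i _.
  by rewrite iter_subdivision_nil homotopy_nil.
have := iter_homotopyP (F := F) (@barycenter 0) N << vertices 0 >>.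
rewrite Hnil addr0 => HtE.
rewrite [singular_homotopy _ _ _ _]singular_opU.
rewrite [singular_subdivision _ _ _ _]singular_opU chain_map_boundary.
rewrite [boundary _ _ _ _ (realize _ _)]realize_boundary.
move: HtE => /(congr1 (fun e => chain_map R F s 0 (realize 0 e))).
by rewrite !linearD !linearN realize_vertices.
Qed.

End AffineSimplices.

(** * Iterated subdivision makes chains small *)

Section Mesh.
Variables (R : realType) (F : fieldType).
Local Notation simplex := (simplex R).

(** A consequence of being in the convex hull that suffices for all estimates:
    in each coordinate, intervals that contain [s] contain [p]. *)
Definition in_hull k (s : seq (simplex k)) (p : simplex k) : Prop :=
  forall j x M, (forall q, q \in s -> `|bcoord q j - x| <= M) ->
    `|bcoord p j - x| <= M.

Definition mesh_le k (d : R) (s : seq (simplex k)) : Prop :=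
  forall p q j, p \in s -> q \in s -> `|bcoord p j - bcoord q j| <= d.

Lemma comb_in_hull m k (s : seq (simplex k)) (t : simplex m) :
  size s = m.+1 -> in_hull s (comb s t).
Proof.
move=> sm j x M sM; rewrite bcoord_comb.
rewrite -[x]mul1r -(sum_bcoord t) mulr_suml -sumrB.
rewrite -[M]mul1r -(sum_bcoord t) mulr_suml.
apply: le_trans (ler_norm_sum _ _ _) _; apply: ler_sum => i _.
rewrite -mulrBr normrM (ger0_norm (bcoord_ge0 t i)).
by rewrite ler_wpM2l ?bcoord_ge0 // sM // mem_nth // sm.
Qed.

Lemma barycenter_in_hull k (s : seq (simplex k)) :
  s != [::] -> in_hull s (barycenter s).
Proof.
by move=> s0; apply: comb_in_hull; rewrite prednK // lt0n size_eq0.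
Qed.

Definition shrink (k : nat) : R := 1 - k.+1%:R^-1.

Lemma shrink_ge0 k : 0 <= shrink k.
Proof. by rewrite subr_ge0 invf_le1 ?ltr0n // ler1n. Qed.

Lemma shrink_lt1 k : shrink k < 1.
Proof. by rewrite ltrBlDr ltrDl invr_gt0 ltr0n. Qed.

(** Of the n+1 differences to [p] that the barycenter averages, the one for [p]
    itself is zero, so the distance is at most n/(n+1) times the mesh. Bounding
    n by a fixed [K] gives one factor for all faces of a simplex. *)
Lemma barycenter_dist k K d (s : seq (simplex k)) p j :
  (size s <= K.+1)%N -> mesh_le d s -> p \in s ->
  `|bcoord p j - bcoord (barycenter s) j| <= shrink K * d.
Proof.
move=> sK sd ps.
have d0 : 0 <= d by apply: le_trans (sd p p j ps ps); rewrite normr_ge0.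
have [n sn] : exists n, size s = n.+1.
  by exists (size s).-1; rewrite prednK //; case: (s) ps.
have ns : (index p s < n.+1)%N by rewrite -sn index_mem.
rewrite distrC /barycenter bcoord_comb sn /=.
under eq_bigr do rewrite bcoord_centroid.
have n0 : n.+1%:R != 0 :> R by rewrite pnatr_eq0.
have -> : \sum_(i < n.+1) n.+1%:R^-1 * bcoord (nth (vertex R ord0) s i) j
    - bcoord p j = n.+1%:R^-1 *
    \sum_(i < n.+1) (bcoord (nth (vertex R ord0) s i) j - bcoord p j).
  rewrite sumrB mulrBr mulr_sumr sumr_const card_ord.
  rewrite -[bcoord p j *+ _]mulr_natl mulrA.
  by rewrite mulVf // mul1r.
rewrite (bigD1 (Ordinal ns)) //= nth_index // subrr add0r.
rewrite normrM ger0_norm ?invr_ge0 ?ler0n //.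
apply: (@le_trans _ _ (n.+1%:R^-1 * (n%:R * d))).
  rewrite ler_wpM2l ?invr_ge0 ?ler0n //.
  apply: le_trans (ler_norm_sum _ _ _) _.
  apply: (@le_trans _ _ (\sum_(i < n.+1 | i != Ordinal ns) d)).
    by apply: ler_sum => i _; apply: sd => //; rewrite mem_nth // sn.
  by rewrite sumr_const cardC1 card_ord -[d *+ _]mulr_natl.
rewrite mulrA ler_wpM2r // /shrink.
have -> : n%:R = n.+1%:R - 1 :> R by rewrite -natr1 addrK.
rewrite mulrBr mulVf // mulr1 lerD2l lerN2 lef_pV2 ?posrE ?ltr0n //.
by rewrite ler_nat -sn.
Qed.

(** A piece is a cone with apex the barycenter of [s] over a piece of a face.
    Within the base the mesh is bounded by induction; the distance of the apex
    to a point of the base is at most its distance to the points of [s],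
    because the base lies in their hull. *)
Lemma subdivision_pieces k K d (s : seq (simplex k)) :
  (size s <= K.+1)%N -> mesh_le d s ->
  supported (fun t : seq (simplex k) => [/\ size t = size s,
      forall p, p \in t -> in_hull s p & mesh_le (shrink K * d) t])
    (subdivision (@barycenter R k) << s >> : lchain F _).
Proof.
have [n] := ubnP (size s); elim: n s => // n IHn s sn sK sd.
have [->|s0] := eqVneq s [::].
  by rewrite subdivision_nil; apply: supportedU; split.
rewrite subdivisionE //; apply: supported_fglift.
pose Q (t : seq (simplex k)) := [/\ size t = (size s).-1,
  forall p, p \in t -> in_hull s p & mesh_le (shrink K * d) t].
have s1 : (size s).-1.+1 = size s by rewrite prednK // lt0n size_eq0.
have : supported Q
    (subdivision (@barycenter R k) (seq_boundary F s) : lchain F _).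
  apply: supported_linear => [|u v|a u|u us].
  - exact: supported0.
  - exact: supportedD.
  - exact: supportedZ.
  have u_s := seq_boundary_sub us; have szu := size_seq_boundary us.
  have ltun : (size u < n)%N by rewrite szu -ltnS s1.
  have uK : (size u <= K.+1)%N by rewrite szu (leq_trans (leq_pred _)).
  have ud : mesh_le d u by move=> p q j /u_s ps /u_s qs; exact: sd.
  apply: (sub_supported (IHn u ltun uK ud)) => t [tu tp td]; split => //.
  - by rewrite tu szu.
  - by move=> p /tp up j x M sM; apply: up => q /u_s; exact: sM.
move=> Sds; apply: (sub_supported Sds) => t [ts tp td]; apply: supportedU.
have bd p j : p \in t ->
    `|bcoord p j - bcoord (barycenter s) j| <= shrink K * d.
  by move=> /tp; apply=> q qs; exact: barycenter_dist.
split=> [|p|p q j]; first by rewrite /= ts s1.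
  by rewrite inE => /predU1P[->|/tp //]; exact: barycenter_in_hull.
rewrite !inE => /predU1P[->|pt] /predU1P[->|qt]; last exact: td.
- rewrite subrr normr0 mulr_ge0 ?shrink_ge0 //.
  case: (s) s0 sd => // v s' _ sd.
  by apply: le_trans (sd v v j _ _); rewrite ?mem_head ?normr_ge0.
- by rewrite distrC bd.
- exact: bd.
Qed.

Lemma iter_subdivision_mesh k K d N (s : seq (simplex k)) :
  (size s <= K.+1)%N -> mesh_le d s ->
  supported (fun t : seq (simplex k) =>
      size t = size s /\ mesh_le (shrink K ^+ N * d) t)
    (iter N (subdivision (@barycenter R k)) << s >> : lchain F _).
Proof.
move=> sK sd; elim: N => [|N IHN].
  by rewrite /= expr0 mul1r; exact: supportedU.
rewrite iterS; apply: supported_linear => [|u v|a u|u us].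
- exact: supported0.
- exact: supportedD.
- exact: supportedZ.
have [szu ud] := IHN u us; rewrite exprS -mulrA.
have uK : (size u <= K.+1)%N by rewrite szu.
by apply: (sub_supported (subdivision_pieces uK ud)) => t [-> _ td].
Qed.

Lemma bcoord_le1 k (p : simplex k) j : bcoord p j <= 1.
Proof.
rewrite -(sum_bcoord p) (bigD1 j) //= lerDl sumr_ge0 // => i _.
exact: bcoord_ge0.
Qed.

Lemma vertices_mesh k : mesh_le 1 (vertices R k).
Proof.
move=> p q j _ _; rewrite ler_norml.
have [p0 p1] := (bcoord_ge0 p j, bcoord_le1 p j).
have [q0 q1] := (bcoord_ge0 q j, bcoord_le1 q j).
by apply/andP; split; lra.
Qed.

Lemma simplex_nbhs k (p : simplex k) (A : set (simplex k)) : nbhs p A ->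
  exists2 e : R, 0 < e &
    forall q, (forall j, `|bcoord q j - bcoord p j| < e) -> A q.
Proof.
move=> [_ [[O Oop <-] Op] OA].
have /nbhs_ballP[e /= e0 eO] : nbhs (set_val p : 'rV[R]_k.+1) O.
  exact: open_nbhs_nbhs.
exists e => // q qp; apply: OA; apply: eO; split=> // i j.
by rewrite ord1 -ball_normE /= distrC; exact: qp.
Qed.

Lemma std_simplex_compact k : compact (std_simplex (R := R) (k := k)).
Proof.
have cube : compact
    [set v : 'rV[R]_k.+1 | forall i, `[0, 1]%classic (v ord0 i)].
  apply: (@matrix_normedtype.rV_compact R _ (fun=> `[0, 1]%classic)) => _.
  exact: segment_compact.
apply: (subclosed_compact _ cube) => [|v [v0 v1] i]; last first.
  by rewrite /= in_itv /= v0 -v1 (bigD1 i) //= lerDl sumr_ge0.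
rewrite (_ : std_simplex (k := k) =
    (\bigcap_(i in [set: 'I_k.+1]) [set v | 0 <= v ord0 i]) `&`
    [set v | \sum_i v ord0 i = 1]); last first.
  apply/seteqP; split=> v [v0 v1]; split=> // i; first by move=> _; exact: v0.
  by have := v0 i; apply.
have cc (i : 'I_k.+1) : continuous (fun v : 'rV[R]_k.+1 => v ord0 i).
  exact: matrix_normedtype.coord_continuous.
apply: closedI.
  apply: closed_bigI => i _.
  apply: (@closed_comp _ _ (fun v : 'rV[R]_k.+1 => v ord0 i) [set x | 0 <= x]).
    by move=> v _; exact: cc.
  exact: closed_ge.
apply: (@closed_comp _ _ (fun v : 'rV[R]_k.+1 => \sum_i v ord0 i)
  [set x | x = 1]); last exact: closed_eq.
by move=> v _; apply: continuous_sum => i; exact: cc.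
Qed.

(** A form of the Lebesgue number lemma, with the radius tending to zero along
    powers of [rho]. *)
Lemma lebesgue_near k (P1 P2 : set (simplex k)) (rho : R) : `|rho| < 1 ->
  (forall p : simplex k, nbhs p P1 \/ nbhs p P2) ->
  \forall N \near \oo, forall p,
    (forall q, (forall j, `|bcoord q j - bcoord p j| <= rho ^+ N) -> P1 q) \/
    (forall q, (forall j, `|bcoord q j - bcoord p j| <= rho ^+ N) -> P2 q).
Proof.
move=> rho1 cov.
pose good N (v : 'rV[R]_k.+1) := forall p : simplex k, set_val p = v ->
  (forall q, (forall j, `|bcoord q j - bcoord p j| <= rho ^+ N) -> P1 q) \/
  (forall q, (forall j, `|bcoord q j - bcoord p j| <= rho ^+ N) -> P2 q).
suff : \forall N \near \oo, std_simplex (k := k) `<=` good N.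
  apply: filterS => N goodN p; apply: (goodN (set_val p)) => //.
  exact: set_valP.
have /compact_near_coveringP := @std_simplex_compact k; apply => v vS.
pose p0 : simplex k := SigSub (mem_set vS).
have [e e0 eP] : exists2 e : R, 0 < e &
    (forall q, (forall j, `|bcoord q j - bcoord p0 j| < e) -> P1 q) \/
    (forall q, (forall j, `|bcoord q j - bcoord p0 j| < e) -> P2 q).
  by case: (cov p0) => /simplex_nbhs[e e0 eP]; exists e => //; [left|right].
(* Half of [e] for the distance to the centre, half for the radius. *)
have e20 : 0 < e / 2 by rewrite divr_gt0.
have rhoN : \forall N \near \oo, `|rho ^+ N| < e / 2.
  have /cvgr0Pnorm_lt := cvg_expr rho1; exact.
exists (ball v (e / 2), [set N | `|rho ^+ N| < e / 2]) => /=.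
  by split=> //; exact: nbhsx_ballx.
move=> [w N] [/= [_ vw] rN] p pw.
have near0 q : (forall j, `|bcoord q j - bcoord p j| <= rho ^+ N) ->
    forall j, `|bcoord q j - bcoord p0 j| < e.
  move=> qp j; rewrite -(subrK (bcoord p j) (bcoord q j)) -addrA.
  apply: le_lt_trans (ler_normD _ _) _; rewrite [ltRHS]splitr ler_ltD //.
    by apply: le_trans (qp j) _; apply: le_trans (ler_norm _) (ltW rN).
  by have := vw ord0 j; rewrite -ball_normE /= distrC -pw.
by case: eP => eP; [left|right] => q /near0; exact: eP.
Qed.

(** A piece is [s] composed with an affine simplex all of whose points are near
    its first vertex, and [s] maps a neighbourhood of that vertex into A or
    B. *)
Lemma subdivision_small k (Y : topologicalType) (A B : set Y)
    (s : singular_simplex R k Y) :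
  (forall y : Y, nbhs y A \/ nbhs y B) ->
  \forall N \near \oo, supported
    (fun t : singular_simplex R k Y =>
      (forall a, A (t a)) \/ (forall a, B (t a)))
    (singular_subdivision R F N k Y << s >>).
Proof.
move=> AB.
have sh1 : `|shrink k| < 1 by rewrite ger0_norm ?shrink_ge0 // shrink_lt1.
have cov (p : simplex k) : nbhs p (s @^-1` A) \/ nbhs p (s @^-1` B).
  have cs : continuous s by exact: cts_fun.
  by case: (AB (s p)) => [/cs|/cs]; [left|right].
have := lebesgue_near sh1 cov; apply: filterS => N NP.
rewrite [singular_subdivision _ _ _ _ _ _]singular_opU.
have := @iter_subdivision_mesh k k 1 N (vertices R k) _ (@vertices_mesh k).
rewrite size_vertices mulr1 => /(_ (leqnn _)) small.
apply: (supported_linear (f := chain_map R F s k \o @realize R F k k)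
  (S := supported _)) => [|u v|a u|t t_Sd].
- exact: supported0.
- exact: supportedD.
- exact: supportedZ.
rewrite -[X in supported _ X]/(chain_map R F s k (realize k << t >>)).
have [st td] := small _ t_Sd.
rewrite realizeU st eqxx chain_mapU; apply: supportedU.
have t_near p (a : simplex k) j : p \in t ->
    `|bcoord (comb t a) j - bcoord p j| <= shrink k ^+ N.
  by move=> pt; have := comb_in_hull a st; apply=> q qt; exact: td.
have t0 : nth (vertex R ord0) t 0 \in t by rewrite mem_nth // st.
case: (NP (nth (vertex R ord0) t 0)) => sP; [left|right] => a;
  apply: (sP (comb t a)) => j; exact: t_near.
Qed.

(** One number of subdivisions serves the finitely many simplices of a chain. *)
Lemma subdivision_small_chain k (Y : topologicalType) (A B : set Y)
    (c : chains R F k Y) :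
  (forall y : Y, nbhs y A \/ nbhs y B) ->
  exists N, supported
    (fun t : singular_simplex R k Y =>
      (forall a, A (t a)) \/ (forall a, B (t a)))
    (singular_subdivision R F N k Y c).
Proof.
move=> AB; suff /filter_ex[N NP] : \forall N \near \oo, supported
    (fun t : singular_simplex R k Y =>
      (forall a, A (t a)) \/ (forall a, B (t a)))
    (singular_subdivision R F N k Y c) by exists N; exact: NP.
rewrite (freeg_sum_scale c).
elim: (dom c) => [|s r IHr].
  by near=> N; rewrite big_nil linear0; exact: supported0.
have sN := subdivision_small s AB; near=> N.
rewrite big_cons linearD linearZ; apply: supportedD; last by near: N.
by apply: supportedZ; near: N.
Unshelve. all: by end_near. Qed.

End Mesh.

(** * Chains in subspaces and the small chain theorem *)

Section Subspaces.
Variables (R : realType) (F : fieldType) (X : topologicalType).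
Implicit Types S T : set X.
Local Notation incl := Defs.incl.

Definition lands k T S (s : singular_simplex R k (set_type T)) : Prop :=
  forall a, S (set_val (s a)).

Section Corestriction.
Variables (k : nat) (T S : set X) (s : singular_simplex R k (set_type T)).
Hypothesis sS : lands S s.

Definition corestrict_fun (a : simplex R k) : set_type S :=
  SigSub (mem_set (sS a)).

Lemma corestrict_continuous : continuous corestrict_fun.
Proof.
apply: continuous_comp_initial => a; apply: (@continuous_comp _ (set_type T) X s
  (set_val : set_type T -> X)); last exact: initial_continuous.
exact: cts_fun.
Qed.

Definition corestrict : singular_simplex R k (set_type S) :=
  mkcts corestrict_continuous.

End Corestriction.

(** Left inverse to the inclusion of chains: simplices that leave [S] are
    dropped. *)
Definition restrict k T S :
    chains R F k (set_type T) -> chains R F k (set_type S) :=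
  fglift (fun s => if pselect (lands S s) is left sS then << corestrict sS >>
                   else 0).

HB.instance Definition _ k T S := GRing.Linear.on (@restrict k T S).

Lemma restrict_inclK k S T (ST : S `<=` T) (c : chains R F k (set_type S)) :
  restrict S (chain_map R F (incl ST) k c) = c.
Proof.
apply: (eq_linear_freeg (f := @restrict k T S \o chain_map R F (incl ST) k)
  (g := idfun)) => s.
rewrite -[LHS]/(restrict S (chain_map R F (incl ST) k << s >>)) chain_mapU.
rewrite [LHS]fgliftU1; case: pselect => [sS|]; last first.
  by case=> a; exact: (set_valP (s a)).
by congr << _ >>; apply/continuousEP => a; exact: val_inj.
Qed.

Lemma chain_incl_inj k S T (ST : S `<=` T) :
  injective (chain_map R F (incl ST) k).
Proof. exact: can_inj (restrict_inclK ST). Qed.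

Lemma chain_incl_supported k S T (ST : S `<=` T)
    (c : chains R F k (set_type S)) :
  supported (@lands k T S) (chain_map R F (incl ST) k c).
Proof.
apply: supported_fglift => s _; apply: supportedU => a.
exact: (set_valP (s a)).
Qed.

Lemma incl_restrictK k S T (ST : S `<=` T) (c : chains R F k (set_type T)) :
  supported (@lands k T S) c ->
  chain_map R F (incl ST) k (restrict S c) = c.
Proof.
move=> cS; apply: (eq_linear_supported
  (f := chain_map R F (incl ST) k \o @restrict k T S) (g := idfun)) => s /cS sS.
rewrite -[LHS]/(chain_map R F (incl ST) k (restrict S << s >>)).
rewrite [restrict _ _]fgliftU1.
case: pselect => // sS'; rewrite chain_mapU; congr << _ >>.
by apply/continuousEP => a; exact: val_inj.
Qed.

Lemma chain_incl_comp k S T V (ST : S `<=` T) (TV : T `<=` V) (SV : S `<=` V)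
    (c : chains R F k (set_type S)) :
  chain_map R F (incl TV) k (chain_map R F (incl ST) k c) =
  chain_map R F (incl SV) k c.
Proof.
rewrite -chain_map_comp; congr (chain_map _ _ _ _ _).
by apply/continuousEP => a; exact: val_inj.
Qed.

Section Cover.
Variables (T A B I : set X) (AT : A `<=` T) (BT : B `<=` T).
Variables (IA : I `<=` A) (IB : I `<=` B).

Lemma chain_incl_square k (c : chains R F k (set_type I)) :
  chain_map R F (incl AT) k (chain_map R F (incl IA) k c) =
  chain_map R F (incl BT) k (chain_map R F (incl IB) k c).
Proof.
by rewrite !(chain_incl_comp _ _ (subset_trans IA AT)).
Qed.

(** A chain of A and a chain of B with the same image consist of simplices
    lying in both, hence in I. *)
Lemma chain_incl_pullback k (a : chains R F k (set_type A))
    (b : chains R F k (set_type B)) :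
  A `&` B `<=` I ->
  chain_map R F (incl AT) k a = chain_map R F (incl BT) k b ->
  exists z, chain_map R F (incl IA) k z = a /\ chain_map R F (incl IB) k z = b.
Proof.
move=> ABI ab; have IT := subset_trans IA AT.
have cI : supported (@lands k T I) (chain_map R F (incl AT) k a).
  move=> s sa p; apply: ABI; split; first exact: (chain_incl_supported sa).
  by rewrite ab in sa; exact: (chain_incl_supported sa).
exists (restrict I (chain_map R F (incl AT) k a)).
split; [apply: (chain_incl_inj (ST := AT))|apply: (chain_incl_inj (ST := BT))];
  by rewrite (chain_incl_comp _ _ IT) incl_restrictK.
Qed.

Lemma small_chain_split k (c : chains R F k (set_type T)) :
  supported (fun s => lands A s \/ lands B s) c ->
  exists a b, c = chain_map R F (incl AT) k a + chain_map R F (incl BT) k b.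
Proof.
move=> cAB; apply: (supported_ind (S := fun c => exists a b,
  c = chain_map R F (incl AT) k a + chain_map R F (incl BT) k b)).
- by exists 0, 0; rewrite !linear0 addr0.
- move=> u v [a [b ->]] [a' [b' ->]]; exists (a + a'), (b + b').
  by rewrite !linearD addrACA.
- move=> e u [a [b ->]]; exists (e *: a), (e *: b).
  by rewrite !linearZ scalerDr.
move=> s /cAB[sA|sB].
  exists (restrict A << s >>), 0; rewrite linear0 addr0 incl_restrictK //.
  exact: supportedU.
exists 0, (restrict B << s >>); rewrite linear0 add0r incl_restrictK //.
exact: supportedU.
Qed.

Hypothesis AB_cover : forall y : set_type T,
  nbhs y (set_val @^-1` A) \/ nbhs y (set_val @^-1` B).

Lemma subdivision_split k (c : chains R F k (set_type T)) :
  exists N a b, singular_subdivision R F N k (set_type T) c =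
    chain_map R F (incl AT) k a + chain_map R F (incl BT) k b.
Proof.
have [N /small_chain_split cN] := subdivision_small_chain c AB_cover.
by exists N.
Qed.

(** For a cycle x the homotopy formula reads x - Sd x = dT x. *)
Lemma small_cycle k (x : chains R F k (set_type T)) :
  boundary R F k _ x = 0 ->
  exists a b e, x = chain_map R F (incl AT) k a + chain_map R F (incl BT) k b +
    boundary R F k.+1 _ e.
Proof.
have [N [a [b xab]]] := subdivision_split x => x0.
exists a, b, (singular_homotopy R F N k _ x); rewrite -xab.
case: k x x0 {a b xab} => [|k] x x0.
  by rewrite singular_homotopy0 addrC subrK.
have := singular_homotopyP N x; rewrite x0 linear0 addr0 => ->.
by rewrite addrC subrK.
Qed.

(** If the small chain w is the boundary of e, then e - Sd e = dT e + T w, so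
    that w = d(Sd e + T w). Here Sd e is small for many subdivisions, and T w
    is small because T is natural for the inclusions of A and B. *)
Lemma small_boundary k (a : chains R F k (set_type A))
    (b : chains R F k (set_type B)) (e : chains R F k.+1 (set_type T)) :
  chain_map R F (incl AT) k a + chain_map R F (incl BT) k b =
    boundary R F k.+1 _ e ->
  exists a' b', chain_map R F (incl AT) k a + chain_map R F (incl BT) k b =
    chain_map R F (incl AT) k (boundary R F k.+1 _ a') +
    chain_map R F (incl BT) k (boundary R F k.+1 _ b').
Proof.
move=> abe; have [N [a' [b' eab]]] := subdivision_split e.
have Ht_natural S (ST : S `<=` T) (c : chains R F k (set_type S)) :
    singular_homotopy R F N k _ (chain_map R F (incl ST) k c) =
    chain_map R F (incl ST) k.+1 (singular_homotopy R F N k _ c).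
  exact/esym/(singular_op_natural (@simplex_homotopy R F N) k.+1 (incl ST)).
exists (a' + singular_homotopy R F N k _ a).
exists (b' + singular_homotopy R F N k _ b).
have SdE : singular_subdivision R F N k.+1 _ e +
    singular_homotopy R F N k _ (boundary R F k.+1 _ e) =
    e - boundary R F k.+2 _ (singular_homotopy R F N k.+1 _ e).
  apply/eqP; rewrite eq_sym subr_eq -addrA [X in _ + X]addrC.
  by rewrite singular_homotopyP addrC subrK.
rewrite -!boundary_chain_map -linearD [chain_map _ _ (incl AT) k.+1 _]linearD.
rewrite [chain_map _ _ (incl BT) k.+1 _]linearD addrACA -eab -!Ht_natural.
rewrite -linearD abe.
by rewrite SdE linearB boundaryK subr0.
Qed.

End Cover.
End Subspaces.

(** * Homology classes through representing chains *)

Section Represents.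
Variables (R : realType) (F : fieldType).

(** Working with representing chains, rather than with the cycles and
    quotients that encode homology, keeps the diagram chases at the level of
    chains. *)
Definition represents k Y (c : chains R F k Y) (h : singular_homology R F k Y) :
    Prop :=
  exists2 z : cycles (boundary R F k Y), chain_of z = c & hclass _ _ z = h.

Lemma hclass_represents k Y (z : cycles (boundary R F k Y)) :
  represents (chain_of z) (hclass (boundary R F k.+1 Y) _ z).
Proof. by exists z. Qed.

Lemma represents_class k Y (h : singular_homology R F k Y) :
  exists c, represents c h.
Proof.
by exists (chain_of (repr h)); exists (repr h) => //; exact: hclass_repr.
Qed.

Lemma represents_cycle k Y (c : chains R F k Y) h :
  represents c h -> boundary R F k Y c = 0.
Proof. by move=> [z <- _]; exact: cycleP. Qed.

Lemma cycle_represents k Y (c : chains R F k Y) :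
  boundary R F k Y c = 0 -> exists h, represents c h.
Proof.
move=> /eqP c0; pose z := Cycle (c0 : is_cycle (boundary R F k Y) c).
by exists (hclass _ _ z), z.
Qed.

Lemma represents_eq k Y (c c' : chains R F k Y) h h' :
  represents c h -> represents c' h' ->
  h = h' <-> exists e, c - c' = boundary R F k.+1 Y e.
Proof. by move=> [z <- <-] [z' <- <-]; exact: hclass_eq. Qed.

Lemma represents0 k Y : represents 0 (0 : singular_homology R F k Y).
Proof. by exists 0; rewrite linear0. Qed.

Lemma represents_eq0 k Y (c : chains R F k Y) h : represents c h ->
  h = 0 <-> exists e, c = boundary R F k.+1 Y e.
Proof.
move=> ch; rewrite (represents_eq ch (represents0 k Y)).
by under eq_exists do rewrite subr0.
Qed.

Lemma represents_fun k Y (c : chains R F k Y) h h' :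
  represents c h -> represents c h' -> h = h'.
Proof.
by move=> ch ch'; apply/(represents_eq ch ch'); exists 0; rewrite subrr linear0.
Qed.

Lemma represents_linear k Y a (c c' : chains R F k Y) h h' :
  represents c h -> represents c' h' ->
  represents (a *: c + c') (a *: h + h').
Proof.
by move=> [z <- <-] [z' <- <-]; exists (a *: z + z'); rewrite linearP.
Qed.

Lemma represents_homologous k Y (c : chains R F k Y) e h :
  represents (c + boundary R F k.+1 Y e) h -> represents c h.
Proof.
move=> ceh; have c0 : boundary R F k Y c = 0.
  by rewrite -(represents_cycle ceh) linearD boundaryK addr0.
have [h' ch'] := cycle_represents c0; suff -> : h = h' by [].
by apply/(represents_eq ceh ch'); exists e; rewrite addrAC subrr add0r.
Qed.

Lemma represents_map k (Y Z : topologicalType) (f : continuousType Y Z)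
    (c : chains R F k Y) h :
  represents c h ->
  represents (chain_map R F f k c) (singular_homology_map R F f k h).
Proof.
move=> [z <- <-]; rewrite singular_homology_mapE.
by exists (Defs.cycle_map (@chain_map_boundary R F Y Z f k) z).
Qed.

Lemma represents_split k Y (c c' : chains R F k Y) h :
  represents (c + c') h -> boundary R F k Y c = 0 ->
  exists h1 h2, [/\ represents c h1, represents c' h2 & h = h1 + h2].
Proof.
move=> cc'h c0; have c'0 : boundary R F k Y c' = 0.
  by rewrite -(represents_cycle cc'h) linearD c0 add0r.
have [[h1 ch1] [h2 ch2]] := (cycle_represents c0, cycle_represents c'0).
exists h1, h2; split=> //; apply: represents_fun cc'h _.
by rewrite -[c]scale1r -[h1]scale1r; exact: represents_linear.
Qed.

End Represents.

(** * The Mayer-Vietoris sequence of a triad *)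

Section Triad.
Variables (R : realType) (F : fieldType) (Z ZA ZB ZI : topologicalType).
Variables (jA : continuousType ZA Z) (jB : continuousType ZB Z).
Variables (iA : continuousType ZI ZA) (iB : continuousType ZI ZB).

Local Notation C k Y := (chains R F k Y).
Local Notation H k Y := (singular_homology R F k Y).
Local Notation "f ^#" := (chain_map R F f _) (at level 1, format "f ^#").
Local Notation "f ^!" := (singular_homology_map R F f _)
  (at level 1, format "f ^!").
Local Notation bd k Y := (boundary R F k Y).

(** The properties of chains on which the Mayer-Vietoris sequence depends. The
    last two say that small chains compute the homology of [Z]. *)
Record excisive_triad : Prop := ExcisiveTriad {
  triad_jB_inj : forall k, injective (chain_map R F jB k);
  triad_iA_inj : forall k, injective (chain_map R F iA k);
  triad_square : forall k (c : C k ZI), jA^# (iA^# c) = jB^# (iB^# c);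
  triad_pullback : forall k (a : C k ZA) (b : C k ZB),
    jA^# a = jB^# b -> exists z : C k ZI, iA^# z = a /\ iB^# z = b;
  triad_small_cycle : forall k (x : C k Z), bd k Z x = 0 ->
    exists (a : C k ZA) (b : C k ZB) e, x = jA^# a + jB^# b + bd k.+1 Z e;
  triad_small_boundary : forall k (a : C k ZA) (b : C k ZB) (e : C k.+1 Z),
    jA^# a + jB^# b = bd k.+1 Z e ->
    exists a' b', jA^# a + jB^# b = jA^# (bd k.+1 ZA a') + jB^# (bd k.+1 ZB b')
}.

Hypothesis triad : excisive_triad.
Let jB_inj := triad_jB_inj triad.
Let iA_inj := triad_iA_inj triad.
Let square := triad_square triad.
Let pullback := triad_pullback triad.
Let small_cycleP := triad_small_cycle triad.
Let small_boundaryP := triad_small_boundary triad.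

Lemma small_class k (h : H k Z) : exists a b, represents (jA^# a + jB^# b) h.
Proof.
have [x xh] := represents_class h.
have [a [b [e xE]]] := small_cycleP (represents_cycle xh).
by exists a, b; apply: (@represents_homologous _ _ _ _ _ e); rewrite -xE.
Qed.

(** The correction [z] is the chain of the intersection by which the two
    summands of a bounding small cycle fail to bound separately. *)
Lemma small_boundary_split k (a : C k ZA) (b : C k ZB) (e : C k.+1 Z) :
  jA^# a + jB^# b = bd k.+1 Z e ->
  exists a' b' z, a = bd k.+1 ZA a' + iA^# z /\ b = bd k.+1 ZB b' - iB^# z.
Proof.
move=> /small_boundaryP[a' [b' ab]].
have /pullback[z [za zb]] :
    jA^# (a - bd k.+1 ZA a') = jB^# (bd k.+1 ZB b' - b).
  rewrite !linearB; apply/eqP; rewrite subr_eq addrAC -subr_eq opprK; apply/eqP.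
  by rewrite ab addrC.
by exists a', b', z; rewrite za zb addrC subrK opprB addrC subrK.
Qed.

(** The relation that defines the connecting map: [h] is the class of a small
    cycle whose part in A has boundary a cycle of class [g]. *)
Definition connects k (h : H k.+1 Z) (g : H k ZI) : Prop :=
  exists a b y, [/\ represents (jA^# a + jB^# b) h, represents y g &
    iA^# y = bd k.+1 ZA a].

Lemma connects_total k (h : H k.+1 Z) : exists g, connects h g.
Proof.
have [a [b abh]] := small_class h.
have := represents_cycle abh; rewrite linearD !boundary_chain_map => ab0.
have /pullback[y [ya yb]] : jA^# (bd k.+1 ZA a) = jB^# (- bd k.+1 ZB b).
  by rewrite linearN; apply/eqP; rewrite -addr_eq0; apply/eqP.
have y0 : bd k ZI y = 0.
  case: k y a ya {yb ab0 abh h b} => // k y a ya; apply: (iA_inj (k := k)).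
  by rewrite -boundary_chain_map ya boundaryK linear0.
have [g yg] := cycle_represents y0.
by exists g, a, b, y.
Qed.

Lemma connects_linear k a (h h' : H k.+1 Z) (g g' : H k ZI) :
  connects h g -> connects h' g' -> connects (a *: h + h') (a *: g + g').
Proof.
move=> [p [q [y [pqh yg ypq]]]] [p' [q' [y' [pqh' yg' ypq']]]].
exists (a *: p + p'), (a *: q + q'), (a *: y + y'); split.
- rewrite !linearP addrACA -scalerDr; exact: represents_linear.
- exact: represents_linear.
- by rewrite !linearP ypq ypq'.
Qed.

(** Independence of choices, by linearity: if a + b bounds, then a is a boundary
    up to a chain z of the intersection, and dz is the boundary of a. *)
Lemma connects0 k (g : H k ZI) : connects 0 g -> g = 0.
Proof.
move=> [a [b [y [ab0 yg ya]]]].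
have /(represents_eq0 ab0)[e] : 0 = 0 :> H k.+1 Z by [].
move=> /small_boundary_split[a' [b' [z [aE _]]]].
apply/(represents_eq0 yg); exists z; apply: (iA_inj (k := k)).
by rewrite ya aE linearD boundaryK add0r boundary_chain_map.
Qed.

Lemma connects_fun k (h : H k.+1 Z) (g g' : H k ZI) :
  connects h g -> connects h g' -> g = g'.
Proof.
move=> hg hg'; apply/eqP; rewrite -subr_eq0 addrC -scaleN1r; apply/eqP.
apply: connects0; have := connects_linear (-1) hg' hg.
by rewrite [-1 *: h]scaleN1r addNr.
Qed.

(** Phrased with cycles so that for the triad of a level it is [is_connecting]
    by conversion. *)
Definition connecting_map k (d : {linear H k.+1 Z -> H k ZI}) : Prop :=
  forall (a : C k.+1 ZA) (b : C k.+1 ZB) (x : cycles (bd k.+1 Z))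
         (y : cycles (bd k ZI)),
    chain_of x = jA^# a + jB^# b -> iA^# (chain_of y) = bd k.+1 ZA a ->
    d (hclass _ _ x) = hclass _ _ y.

Lemma connecting_mapP k (d : {linear H k.+1 Z -> H k ZI}) :
  connecting_map d -> forall h g, connects h g <-> d h = g.
Proof.
move=> dP; have sub h g : connects h g -> d h = g.
  move=> [a [b [_ [[x xab <-] [y <- <-] ya]]]]; exact: dP xab ya.
move=> h g; split=> [/sub //|<-].
by have [g' hg'] := connects_total h; rewrite (sub _ _ hg').
Qed.

Lemma connecting_map_exists k :
  exists d : {linear H k.+1 Z -> H k ZI}, connecting_map d.
Proof.
pose d (h : H k.+1 Z) := projT1 (cid (connects_total h)).
have dP h : connects h (d h) := projT2 (cid (connects_total h)).
have d_lin : linear d.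
  by move=> a h h'; apply: connects_fun (dP _) _; exact: connects_linear.
pose d' : {linear H k.+1 Z -> H k ZI} :=
  HB.pack d (GRing.isLinear.Build F (H k.+1 Z) (H k ZI) _ d d_lin).
exists d' => a b x y xab ya /=; apply: connects_fun (dP _) _.
exists a, b, (chain_of y); rewrite -xab.
by split=> //; exact: hclass_represents.
Qed.

(** If y bounds a in A and b in B, then a - b is a cycle that connects to y. *)
Lemma exact_intersection k (g : H k ZI) :
  iA^! g = 0 /\ iB^! g = 0 <-> exists h : H k.+1 Z, connects h g.
Proof.
split=> [[]|[h [a [b [y [abh yg ya]]]]]].
  have [y yg] := represents_class g.
  move=> /(represents_eq0 (represents_map _ yg))[a ya].
  move=> /(represents_eq0 (represents_map _ yg))[b yb].
  have /cycle_represents[h abh] : bd k.+1 Z (jA^# a + jB^# (- b)) = 0.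
    by rewrite linearD !boundary_chain_map linearN -ya -yb linearN square subrr.
  by exists h, a, (- b), y.
have yA := represents_map iA yg; have yB := represents_map iB yg.
split; first by apply/(represents_eq0 yA); exists a.
apply/(represents_eq0 yB); exists (- b); apply: (jB_inj (k := k)).
have := represents_cycle abh.
rewrite linearD !boundary_chain_map -ya square linearN linearN.
by move=> /eqP; rewrite addr_eq0 => /eqP.
Qed.

Lemma exact_sum k (p : H k ZA) (q : H k ZB) :
  jA^! p + jB^! q = 0 <-> exists g : H k ZI, p = iA^! g /\ q = - iB^! g.
Proof.
have [[a ap] [b bq]] := (represents_class p, represents_class q).
have abpq : represents (jA^# a + jB^# b) (jA^! p + jB^! q).
  rewrite -[jA^# a]scale1r -[jA^! p]scale1r.
  by apply: represents_linear; exact: represents_map.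
split=> [|[g [-> ->]]].
  move=> /(represents_eq0 abpq)[e /small_boundary_split[a' [b' [z [aE bE]]]]].
  have z0 : bd k ZI z = 0.
    apply: (iA_inj (k := k.-1)); rewrite linear0 -chain_map_boundary.
    have := represents_cycle ap; rewrite aE linearD boundaryK add0r; exact.
  have [g zg] := cycle_represents z0; exists g.
  have zA := represents_map iA zg; have zB := represents_map iB zg.
  split.
    by apply/(represents_eq ap zA); exists a'; rewrite aE addrK.
  have zBN : represents (- iB^# z) (- iB^! g).
    rewrite -[- (iB^# z)]addr0 -[- (iB^! g)]addr0 -scaleN1r.
    rewrite -[- (iB^! g)]scaleN1r.
    by apply: represents_linear => //; exact: represents0.
  by apply/(represents_eq bq zBN); exists b'; rewrite bE opprK subrK.
have [y yg] := represents_class g.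
rewrite linearN; apply/eqP; rewrite subr_eq0; apply/eqP.
apply: represents_fun (represents_map jA (represents_map iA yg)) _.
by rewrite square; do 2! apply: represents_map.
Qed.

(** If the boundary of a is that of a chain w of the intersection, then a - w
    and b + w are cycles with the same sum as a and b. *)
Lemma exact_total k (h : H k.+1 Z) :
  connects h (0 : H k ZI) <->
  exists (p : H k.+1 ZA) (q : H k.+1 ZB), h = jA^! p + jB^! q.
Proof.
split=> [[a [b [y [abh y0 ya]]]]|[p [q ->]]]; last first.
  have [[a ap] [b bq]] := (represents_class p, represents_class q).
  exists a, b, 0; rewrite linear0 (represents_cycle ap); split=> //.
    rewrite -[jA^# a]scale1r -[jA^! p]scale1r.
    by apply: represents_linear; exact: represents_map.
  exact: represents0.
have /(represents_eq0 y0)[w yw] : 0 = 0 :> H k ZI by [].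
have /cycle_represents[p pw] : bd k.+1 ZA (a - iA^# w) = 0.
  by rewrite linearB boundary_chain_map -yw ya subrr.
have abE : jA^# a + jB^# b = jA^# (a - iA^# w) + jB^# (b + iB^# w).
  by rewrite linearB linearD square addrACA [- _ + _]addrC subrr addr0.
rewrite abE in abh.
have := represents_split abh.
rewrite boundary_chain_map (represents_cycle pw) linear0.
move=> /(_ erefl)[h1 [h2 [h1P h2P hE]]].
have /cycle_represents[q qw] : bd k.+1 ZB (b + iB^# w) = 0.
  apply: (jB_inj (k := k)); rewrite -boundary_chain_map linear0.
  exact: represents_cycle h2P.
exists p, q; rewrite hE; congr (_ + _).
  exact: represents_fun h1P (represents_map _ pw).
exact: represents_fun h2P (represents_map _ qw).
Qed.

Lemma onto_degree0 (h : H 0 Z) :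
  exists (p : H 0 ZA) (q : H 0 ZB), h = jA^! p + jB^! q.
Proof.
have [a [b abh]] := small_class h.
have [p ap] := cycle_represents (erefl : bd 0 ZA a = 0).
have [q bq] := cycle_represents (erefl : bd 0 ZB b = 0).
exists p, q; apply: represents_fun abh _.
rewrite -[jA^# a]scale1r -[jA^! p]scale1r.
by apply: represents_linear; exact: represents_map.
Qed.

End Triad.

(** * Exactness at each level and in the direct sum *)

Section GradedLift.
Variables (F : fieldType) (P : persmod F).

(** Componentwise choices have finite support as soon as 0 is an admissible
    choice in all large degrees. *)
Lemma gradedmod_choice (S : forall u, P u -> Prop) :
  (forall u, exists m, S u m) -> (exists N, forall u, (N <= u)%N -> S u 0) ->
  exists m : gradedmod P, forall u, S u (m u).
Proof.
move=> S_ex [N S0].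
have S_ex' u : exists m, S u m /\ ((N <= u)%N -> m = 0).
  have [Nu|_] := leqP N u; first by exists 0; split=> //; exact: S0.
  by have [m Sm] := S_ex u; exists m.
pose m u := projT1 (cid (S_ex' u)).
have mP u : S u (m u) /\ ((N <= u)%N -> m u = 0) := projT2 (cid (S_ex' u)).
have m_fin : exists N, forall u, (N <= u)%N -> m u = 0.
  by exists N => u; have [] := mP u.
by exists (GradedMod m_fin) => u; have [] := mP u.
Qed.

End GradedLift.

Section Levels.
Variables (R : realType) (F : fieldType) (X : topologicalType).
Variables (Xf : filtration X) (A B : set X).
Hypothesis AB_cover : interior A `|` interior B = [set: X].

Local Notation jA u := (level_incl Xf (@subsetT _ A) u).
Local Notation jB u := (level_incl Xf (@subsetT _ B) u).
Local Notation iA u := (level_incl Xf (@subIsetl _ A B) u).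
Local Notation iB u := (level_incl Xf (@subIsetr _ A B) u).

(** Within the level u every point belongs to it, so that a neighbourhood of the
    point in A gives one in the level of A. *)
Lemma level_cover u (y : level_space Xf setT u) :
  nbhs y (set_val @^-1` level Xf A u) \/ nbhs y (set_val @^-1` level Xf B u).
Proof.
have levelE (Y : set X) : interior Y (set_val y) ->
    nbhs y (set_val @^-1` level Xf Y u).
  move=> yY; have : nbhs y (set_val @^-1` Y) by exact: initial_continuous yY.
  by apply: filterS => p Yp; split=> //; have [] := set_valP p.
have : (interior A `|` interior B) (set_val y) by rewrite AB_cover.
by case=> /levelE; [left|right].
Qed.

Lemma level_triad u : excisive_triad R F (jA u) (jB u) (iA u) (iB u).
Proof.
split.
- by move=> k; exact: chain_incl_inj.
- by move=> k; exact: chain_incl_inj.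
- by move=> k c; exact: chain_incl_square.
- move=> k a b; apply: chain_incl_pullback => x [[Ax Xx] [Bx _]].
  by split.
- by move=> k x; apply: small_cycle; exact: level_cover.
- by move=> k a b e; apply: small_boundary; exact: level_cover.
Qed.

(** The connecting map is the one singled out by its defining property, since
    for an excisive triad such a map exists and is unique. *)
Lemma connectingP k u h g :
  connects (jA u) (jB u) (iA u) h g <-> connecting R F Xf A B k u h = g.
Proof.
suff dP : connecting_map (jA u) (jB u) (iA u) (connecting R F Xf A B k u).
  exact: (connecting_mapP (level_triad u) dP h g).
rewrite /connecting; case: pselect => [dP|nex]; first exact: projT2 (cid dP).
by case: nex; exact: (connecting_map_exists (level_triad u) k).
Qed.

Lemma connecting_natural k u h :
  connecting R F Xf A B k u.+1
    (singular_homology_map R F (Defs.incl (@level_mono _ Xf setT u)) k.+1 h) =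
  singular_homology_map R F (Defs.incl (@level_mono _ Xf (A `&` B) u)) k
    (connecting R F Xf A B k u h).
Proof.
apply/connectingP.
have [a [b [y [abh yg ya]]]] : connects (jA u) (jB u) (iA u) h
  (connecting R F Xf A B k u h) by apply/connectingP.
exists (chain_map R F (Defs.incl (@level_mono _ Xf A u)) k.+1 a).
exists (chain_map R F (Defs.incl (@level_mono _ Xf B u)) k.+1 b).
exists (chain_map R F (Defs.incl (@level_mono _ Xf (A `&` B) u)) k y).
split.
- have := represents_map (Defs.incl (@level_mono _ Xf setT u)) abh.
  by rewrite linearD; congr (represents (_ + _) _); rewrite -!chain_map_comp;
    congr (chain_map _ _ _ _ _); apply/continuousEP => p; exact: val_inj.
- exact: represents_map.
- rewrite boundary_chain_map -ya -!chain_map_comp; congr (chain_map _ _ _ _ _).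
  by apply/continuousEP => p; exact: val_inj.
Qed.

Lemma delta_level_natural k u h :
  delta_level R F Xf A B k u.+1 (pers_map (pers R F Xf (1 + k) setT) u h) =
  pers_map (pers R F Xf k (A `&` B)) u (delta_level R F Xf A B k u h).
Proof. by case: k h => [k|k] h /=; [exact: connecting_natural|]. Qed.

Lemma Hsing_neg k (Y : topologicalType) (h h' : Hsing R F (Negz k) Y) : h = h'.
Proof. by apply/rowP => -[]. Qed.

Lemma level_exact_intersection (k : int) u
    (y : Hsing R F k (level_space Xf (A `&` B) u)) :
  s_level R F Xf A B k u y = 0 /\ t_level R F Xf A B k u y = 0 <->
  exists h, delta_level R F Xf A B k u h = y.
Proof.
case: k y => [k|k] y; last first.
  by split=> _; [exists 0|split]; exact: Hsing_neg.
have tE : t_level R F Xf A B (Posz k) u y = 0 <->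
    singular_homology_map R F (iB u) k y = 0.
  split=> [/eqP|/= ->]; last exact: oppr0.
  by rewrite /= oppr_eq0 => /eqP.
have exI := exact_intersection (level_triad u) y.
split=> [[sy /tE ty]|[h hy]].
  by have [h /connectingP hy] := exI.1 (conj sy ty); exists h.
by have [sy /tE ty] := exI.2 (ex_intro _ h ((connectingP h y).2 hy)).
Qed.

Lemma level_exact_sum (k : int) u (p : Hsing R F k (level_space Xf A u))
    (q : Hsing R F k (level_space Xf B u)) :
  beta_level (p, q) = 0 <->
  exists y, s_level R F Xf A B k u y = p /\ t_level R F Xf A B k u y = q.
Proof.
case: k p q => [k|k] p q; last first.
  by split=> _; [exists 0; split|]; exact: Hsing_neg.
rewrite (exact_sum (level_triad u) p q).
by split=> -[y [sy ty]]; exists y.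
Qed.

(** In degree 0 the target of the connecting map vanishes, and exactness says
    that every class of degree 0 is a sum of classes of A and of B. *)
Lemma level_exact_total (k : int) u
    (h : Hsing R F (1 + k) (level_space Xf setT u)) :
  delta_level R F Xf A B k u h = 0 <->
  exists (p : Hsing R F (1 + k) (level_space Xf A u))
         (q : Hsing R F (1 + k) (level_space Xf B u)), beta_level (p, q) = h.
Proof.
case: k h => [k|[|k]] h.
- have exT := exact_total (level_triad u) h.
  split=> [dh0|[p [q pqh]]].
    by have [p [q ->]] := exT.1 ((connectingP h 0).2 dh0); exists p, q.
  by apply: (connectingP h 0).1; apply: exT.2; exists p, q.
- have [p [q ->]] := onto_degree0 (level_triad u) h.
  by split=> _; [exists p, q|exact: Hsing_neg].
- by split=> _; [exists 0, 0|]; exact: Hsing_neg.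
Qed.

Lemma delta_linear k : linear (delta R F Xf A B k).
Proof. by apply: gmap_linear => u h; exact: delta_level_natural. Qed.

Lemma range_delta k :
  range (delta R F Xf A B k) = [set y | alpha R F Xf A B k y = 0].
Proof.
apply/seteqP; split=> [_ [m _ <-]|y /= y0].
  have st0 u := (level_exact_intersection (delta_level R F Xf A B k u (m u))).2
    (ex_intro _ _ erefl).
  by congr pair; apply: gradedmod_eq => u; have [] := st0 u.
have [m mP] : exists m : HH R F Xf (1 + k) setT,
    forall u, delta_level R F Xf A B k u (m u) = y u.
  apply: (gradedmod_choice (P := pers R F Xf (1 + k) setT)
    (S := fun u m => delta_level R F Xf A B k u m = y u)) => [u|].
    apply/level_exact_intersection; split.
      exact: (congr1 (fun ab : HH R F Xf k A * HH R F Xf k B => ab.1 u) y0).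
    exact: (congr1 (fun ab : HH R F Xf k A * HH R F Xf k B => ab.2 u) y0).
  by have [N yN] := gcomp_fin y; exists N => u /yN ->; exact: linear0.
by exists m => //; apply: gradedmod_eq.
Qed.

Lemma range_alpha k :
  range (alpha R F Xf A B k) = [set ab | beta R F Xf A B k ab = 0].
Proof.
apply/seteqP; split=> [_ [y _ <-]|[a b] /= ab0].
  by apply: gradedmod_eq => u; apply/level_exact_sum; exists (y u).
have [y yP] : exists y : HH R F Xf k (A `&` B), forall u,
    s_level R F Xf A B k u (y u) = a u /\ t_level R F Xf A B k u (y u) = b u.
  apply: (gradedmod_choice (P := pers R F Xf k (A `&` B)) (S := fun u z =>
    s_level R F Xf A B k u z = a u /\ t_level R F Xf A B k u z = b u)) => [u|].
    apply/level_exact_sum.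
    exact: (congr1 (fun m : HH R F Xf k setT => m u) ab0).
  have [[N aN] [M bM]] := (gcomp_fin a, gcomp_fin b).
  exists (maxn N M) => u; rewrite geq_max => /andP[/aN -> /bM ->].
  by rewrite !linear0.
exists y => //; congr pair; apply: gradedmod_eq => u; by have [] := yP u.
Qed.

Lemma range_beta k :
  range (beta R F Xf A B (1 + k)) = [set m | delta R F Xf A B k m = 0].
Proof.
apply/seteqP; split=> [_ [[a b] _ <-]|m /= m0].
  by apply: gradedmod_eq => u; apply/level_exact_total; exists (a u), (b u).
have [a aP] : exists a : HH R F Xf (1 + k) A, forall u,
    exists q : pers R F Xf (1 + k) B u, beta_level (a u, q) = m u.
  apply: (gradedmod_choice (P := pers R F Xf (1 + k) A)
    (S := fun u p => exists q : pers R F Xf (1 + k) B u,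
      beta_level (p, q) = m u)) => [u|].
    apply/level_exact_total.
    exact: (congr1 (fun y : HH R F Xf k (A `&` B) => y u) m0).
  have [N mN] := gcomp_fin m; exists N => u /mN ->.
  by exists 0; rewrite /beta_level !linear0 addr0.
have [b bP] : exists b : HH R F Xf (1 + k) B, forall u,
    beta_level (a u, b u) = m u.
  apply: (gradedmod_choice (P := pers R F Xf (1 + k) B)
    (S := fun u q => beta_level (a u, q) = m u)) => [//|].
  have [[N aN] [M mM]] := (gcomp_fin a, gcomp_fin m).
  exists (maxn N M) => u; rewrite geq_max => /andP[/aN -> /mM ->].
  by rewrite /beta_level !linear0 addr0.
by exists (a, b) => //; apply: gradedmod_eq.
Qed.

End Levels.

Theorem theorem3p4 (R : realType) (F : fieldType) (X : topologicalType)
    (X_compact : compact [set: X])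
    (A B : set X) (AB_cover : interior A `|` interior B = [set: X])
    (phi : X -> R) (phi_cont : continuous phi)
    (n : nat) (r : nat -> R)
    (r_incr : forall u v : nat, (u < v <= n)%N -> r u < r v)
    (X_first : sublevel phi n r 0 = set0)
    (X_last : sublevel phi n r n = [set: X]) :
  let Xf := sublevel_filtration phi r_incr in
  forall k : int,
    [/\ linear (delta R F Xf A B k),
        range (delta R F Xf A B k) = [set y | alpha R F Xf A B k y = 0],
        range (alpha R F Xf A B k) = [set ab | beta R F Xf A B k ab = 0] &
        range (beta R F Xf A B (1 + k)) = [set m | delta R F Xf A B k m = 0]].
Proof.
move=> Xf k; split.
- exact: delta_linear.
- exact: range_delta.
- exact: range_alpha.
- exact: range_beta.
Qed.
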